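(* Let $q\in(0,1)$ and let $\sigma=(\sigma_1,\sigma_2,\ldots)\in\{+1,-1\}^\infty$ contain infinitely many $+1$'s and infinitely many $-1$'s. The minimal boundary $\Omega_q$ of the symmetric $q$-Gelfand–Tsetlin graph associated to $\sigma$ is equal to its Martin boundary $\Omega_q^{\mathrm{Martin}}$.
   Context: $\mathbb{GT}_N$ is the set of signatures $\lambda=(\lambda_1\ge\cdots\ge\lambda_N)\in\mathbb Z^N$; $s_\lambda(x_1,\ldots,x_N)=\det[x_i^{\lambda_j+N-j}]_{i,j=1}^N/\prod_{i<j}(x_i-x_j)$. Symmetric $q$-Gelfand–Tsetlin graph associated to $\sigma$: the sequence $\{\mathbb{GT}_N,\Lambda^{N+1}_N\}_{N\ge1}$, where for $\lambda\in\mathbb{GT}_{N+1}$ the numbers $\Lambda^{N+1}_N(\lambda,\mu)$, $\mu\in\mathbb{GT}_N$, are the unique coefficients in $$\frac{s_\lambda(x_1,\ldots,x_N,q^{-N})}{s_\lambda(1,q^{-1},\ldots,q^{-N})}=\sum_{\mu\in\mathbb{GT}_N}\Lambda^{N+1}_N(\lambda,\mu)\frac{s_\mu(x_1,\ldots,x_N)}{s_\mu(1,q^{-1},\ldots,q^{1-N})}\quad\text{if }\sigma_{N}=-1,$$ $$\frac{s_\lambda(x_1,\ldots,x_N,q^{N})}{s_\lambda(1,q,\ldots,q^{N})}=\sum_{\mu\in\mathbb{GT}_N}\Lambda^{N+1}_N(\lambda,\mu)\frac{s_\mu(x_1,\ldots,x_N)}{s_\mu(1,q,\ldots,q^{N-1})}\quad\text{if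 }\sigma_{N}=+1.$$ These matrices are stochastic. For $N>k$, $\Lambda^N_k=\Lambda^N_{N-1}\cdots\Lambda^{k+1}_k$. A coherent system is a sequence of probability measures $M_N$ on $\mathbb{GT}_N$, $N\ge1$, with $\sum_{\lambda}M_{N+1}(\lambda)\Lambda^{N+1}_N(\lambda,\mu)=M_N(\mu)$ for all $N\ge1$, $\mu\in\mathbb{GT}_N$. Coherent systems form a convex set. The minimal boundary is the set of its extreme points. The Martin boundary is the set of coherent systems $\{M_k\}_{k\ge1}$ for which there exists a sequence $\{\lambda(N)\in\mathbb{GT}_N\}_{N\ge1}$ with $M_k(\mu)=\lim_{N\to\infty}\Lambda^N_k(\lambda(N),\mu)$ for all $k\ge1$, $\mu\in\mathbb{GT}_k$. *)

(* Defs.v *)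
From mathcomp Require Import all_boot all_order all_algebra.
From mathcomp Require Import all_classical all_reals all_analysis.
Set Implicit Arguments.
Unset Strict Implicit.
Unset Printing Implicit Defensive.
Import Order.TTheory GRing.Theory Num.Theory.
Import numFieldNormedType.Exports.
Local Open Scope classical_set_scope.
Local Open Scope ring_scope.

Definition signature (N : nat) :=
  {l : {ffun 'I_N -> int} | 
     [forall i : 'I_N, forall j : 'I_N, (i <= j)%N ==> (l j <= l i)]}.

(* Columns are numbered from 0, so the exponent lambda_j + N - j becomes
   lambda_j + (N - j.+1).  The quotient is the Schur Laurent polynomial at points
   with nonzero, pairwise distinct coordinates; it is only used there. *)
Definition schur (F : fieldType) (N : nat) (l : signature N) (x : 'I_N -> F) : F :=
  \det (\matrix_(i < N, j < N) x i ^ (val l j + (N - j.+1)%:Z))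
  / \prod_(i < N) \prod_(j < N | (i < j)%N) (x i - x j).

Definition snoc (T : Type) (N : nat) (x : 'I_N -> T) (u : T) : 'I_N.+1 -> T :=
  fun i => if unlift ord_max i is Some j then x j else u.

Definition geom (F : fieldType) (t : F) (N : nat) : 'I_N -> F := fun i => t ^+ i.

Section Graph.
Variables (R : realType) (q : R) (sigma : nat -> int).

(* The base is q if sigma_N = 1 and q^-1 if sigma_N = -1, which covers both cases
   of the defining identity.  The identity between Laurent polynomials in
   x_1, ..., x_N is tested at all points of R^N where every quotient of determinants
   is defined (a Zariski-dense set).  The sum over the infinite set of signatures is
   a finite one, hence the finiteness condition. *)
Definition link_coefficients (N : nat) (l : signature N.+1)
    (c : signature N -> R) : Prop :=
  let t := q ^ sigma N in
  finite_set [set m | c m != 0] /\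
  forall x : 'I_N -> R,
    (forall i, x i != 0) -> injective (snoc x (t ^+ N)) ->
    schur l (snoc x (t ^+ N)) / schur l (geom t (N := N.+1)) =
    \sum_(m \in [set: signature N]) c m * (schur m x / schur m (geom t (N := N))).

(* The coefficients exist and are unique; [get] selects them. *)
Definition link (N : nat) (l : signature N.+1) : signature N -> R :=
  get [set c | link_coefficients l c].

(* In what follows the index k stands for level k.+1, levels being numbered from 1;
   sigma 0 is never used.  [links d k] is the composite link from level (d + k).+1
   to level k.+1 (the identity for d = 0). *)
Fixpoint links (d k : nat) : signature (d + k).+1 -> signature k.+1 -> R :=
  match d return signature (d + k).+1 -> signature k.+1 -> R with
  | 0%N => fun l m => (l == m)%:R
  | d'.+1 => fun l m =>
      \sum_(n \in [set: signature (d' + k).+1]) link l n * links n m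
  end.

(* A measure on the countable set of signatures is given by its weights. *)
Definition system : Type := forall k : nat, signature k.+1 -> R.

Definition is_prob_weights (T : choiceType) (M : T -> R) : Prop :=
  (forall l, 0 <= M l) /\ (\esum_(l in [set: T]) (M l)%:E = 1)%E.

Definition coherent : set system := [set M |
  (forall k, is_prob_weights (M k)) /\
  (forall k (m : signature k.+1),
    \esum_(l in [set: signature k.+2]) (M k.+1 l * link l m)%:E = (M k m)%:E)].

Definition minimal_boundary : set system := [set M |
  coherent M /\
  forall (M1 M2 : system) (a : R), coherent M1 -> coherent M2 -> 0 < a < 1 ->
    (forall k l, M k l = a * M1 k l + (1 - a) * M2 k l) -> M1 = M2].

Definition Martin_boundary : set system := [set M |
  coherent M /\
  exists l : forall N, signature N.+1,
    forall k (m : signature k.+1),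
      (fun d => links (l (d + k)%N) m) @ \oo --> M k m].

End Graph.

(* Main.v *)
Require Import Defs.
From mathcomp Require Import all_boot all_order all_algebra.
From mathcomp Require Import all_classical all_reals all_analysis.
From mathcomp Require Import fingroup perm.
From mathcomp Require Import zify ring lra.
Set Implicit Arguments.
Unset Strict Implicit.
Unset Printing Implicit Defensive.
Import Order.TTheory GRing.Theory Num.Theory.
Import numFieldNormedType.Exports.
Local Open Scope classical_set_scope.
Local Open Scope ring_scope.

(** By homogeneity of Schur functions, level N of the graph may be attached to a
    block of N consecutive powers of q: a step of sign +1 appends the next power
    at one end of the block, a step of sign -1 appends one at the other end.  In
    these terms the branching rule turns the link from lambda into an explicit
    law on the interlacing mu: up to normalization it is a product of truncated
    geometric weights times the product of (1 - q^(e_i - e_j)) over the pairs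
    i < j, where the e_i are the shifted coordinates of mu.  When one
    coordinate leaves its most likely value, the second factor grows at most by
    a bounded ratio, so the coordinate at distance h from the end of the block
    that the link removes is displaced with probability O(q^h) ([step_mass]).  Both signs occur infinitely often, hence every fixed
    position ends up far from both ends, the series of displacement
    probabilities converges, and coordinates freeze.

    Write [window j] for the coordinates that occupy the block of level j inside
    the block of a higher level.  The walk that descends from a signature
    lambda to a level K >= j has two uniform properties.  It keeps [window j]
    with probability at least 1 - [leave_bound j K], which tends to 1 as K grows
    ([cond_mean_leave], [leave_bound_small]).  And it arrives exactly at the
    restriction of lambda to the block of level K with probability at least
    [stay_bound] > 0, which depends on q only ([cond_mean_stay]).

    Let two walks start at signatures with the same [window K] and descend
    independently to level K.  With probability at least [stay_bound]^2 they
    meet, and otherwise they very probably still agree on a smaller window.  So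
    the oscillation of a harmonic function over signatures with a common window
    is multiplied by at most 1 - [stay_bound]^2 when the window grows, and it
    tends to 0 ([oscillation_small]).  A link into a low level is thus, up to a
    small error, a function of a large window alone.

    Both boundaries are then the set of coherent systems for which every window
    converges in probability to a constant ([concentrated]).
    - A system in the Martin boundary is concentrated, because the walk from
      lambda(N) keeps the window of lambda(N) ([Martin_concentrated]).
    - If M is concentrated and a coherent M1 is at most C M, then M1 is
      concentrated at the same windows, which determine its weights, so M1 = M
      ([concentrated_dominates]); in particular M is extreme.
    - If M is extreme, the limiting value of a window is deterministic: an event
      on it of limiting mass w strictly between 0 and 1 would split M into two
      coherent parts, each a multiple of M, whereas the part on the complement
      gives the event vanishing mass ([minimal_tail_mass]).  So M is
      concentrated.
    - If M is concentrated, any signatures that show the limiting windows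
      approximate M ([concentrated_Martin]). *)

(** * The branching rule *)

Definition expo N (l : signature N) (j : 'I_N) : int :=
  val l j + (N - j.+1)%:Z.

Lemma signature_le N (l : signature N) (i j : 'I_N) :
  (i <= j)%N -> val l j <= val l i.
Proof. by move=> ij; have /forallP/(_ i)/forallP/(_ j)/implyP := valP l; apply. Qed.

Lemma expo_lt N (l : signature N) (i j : 'I_N) :
  (i < j)%N -> expo l j < expo l i.
Proof.
move=> ij; have := signature_le l (ltnW ij); rewrite /expo.
by have := ltn_ord i; have := ltn_ord j; lia.
Qed.

Definition gap N (l : signature N.+1) (j : 'I_N) : nat :=
  `|val l (lift ord_max j) - val l (lift ord0 j)|%N.

Lemma gapE N (l : signature N.+1) (j : 'I_N) :
  (gap l j)%:Z = val l (lift ord_max j) - val l (lift ord0 j).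
Proof.
rewrite /gap gez0_abs // subr_ge0; apply: signature_le.
by rewrite lift_max lift0.
Qed.

(** One bound for all gaps, so that the displacements of a signature form a
    plain type of finite functions, cut down by [in_gap]. *)
Definition gap_bound N (l : signature N.+1) : nat := (\max_j gap l j).+1.

Definition in_gap N (l : signature N.+1) (j : 'I_N) : pred 'I_(gap_bound l) :=
  fun v => (v <= gap l j)%N.

Lemma lower_subproof N (l : signature N.+1) (s : {ffun 'I_N -> 'I_(gap_bound l)}) :
  let f := [ffun j : 'I_N => val l (lift ord_max j) - (minn (s j) (gap l j))%:Z] in
  [forall i : 'I_N, forall j : 'I_N, (i <= j)%N ==> (f j <= f i)].
Proof.
apply/forallP => i; apply/forallP => j; apply/implyP => ij; rewrite !ffunE.
have [/eqP/val_inj->//|ne] := boolP (val i == val j).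
have ij' : (i < j)%N by rewrite ltn_neqAle ne.
have : val l (lift ord_max j) <= val l (lift ord0 i).
  by apply: signature_le; rewrite lift_max lift0.
have := gapE l i; have := gapE l j; lia.
Qed.

(** The signatures interlacing l are the l_j - s_j with s_j at most the gap
    l_j - l_(j+1); truncating s_j at the gap makes the value a signature for
    every s. *)
Definition lower N (l : signature N.+1) (s : {ffun 'I_N -> 'I_(gap_bound l)}) :
  signature N :=
  Sub [ffun j => val l (lift ord_max j) - (minn (s j) (gap l j))%:Z]
    (lower_subproof s).

Lemma lowerE N (l : signature N.+1) (s : {ffun 'I_N -> 'I_(gap_bound l)}) j :
  s \in family (in_gap (l := l)) ->
  val (lower s) j = val l (lift ord_max j) - (s j)%:Z.
Proof.
by move=> /familyP/(_ j) sj; rewrite /lower /= ffunE (minn_idPl sj).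
Qed.

Lemma snoc_lift T N (x : 'I_N -> T) u i : snoc x u (lift ord_max i) = x i.
Proof. by rewrite /snoc liftK. Qed.

Lemma snoc_max T N (x : 'I_N -> T) u : snoc x u ord_max = u.
Proof. by rewrite /snoc unlift_none. Qed.

Lemma det_sum_col (F : fieldType) N (J : finType) (Q : 'I_N -> pred J)
    (G : 'I_N -> 'I_N -> J -> F) :
  \det (\matrix_(i, j) \sum_(v | Q j v) G i j v) =
  \sum_(s in family Q) \det (\matrix_(i, j) G i j (s j)).
Proof.
rewrite -[LHS]det_tr /determinant.
under eq_bigr => p _ do under eq_bigr => i _ do rewrite !mxE.
under eq_bigr => p _ do rewrite bigA_distr_big_dep big_distrr /=.
rewrite exchange_big /=; apply: eq_bigr => s _.
rewrite -[RHS]det_tr /determinant; apply: eq_bigr => p _; congr (_ * _).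
by apply: eq_bigr => i _; rewrite !mxE.
Qed.

Lemma exprz_diff_sum (F : fieldType) (x u : F) (e : int) (g B : nat) :
  x != 0 -> (g < B)%N ->
  x ^ (e + g%:Z + 1) - u ^+ g.+1 * x ^ e =
  (x - u) * \sum_(v < B | (v <= g)%N) u ^+ v * x ^ (e + g%:Z - v%:Z).
Proof.
move=> x0 gB.
have -> : e + g%:Z + 1 = g.+1%:Z + e by lia.
rewrite expfzDr // -mulrBl -exprnP subrXX -mulrA; congr (_ * _).
rewrite (big_ord_widen_cond _ xpredT (fun v => x ^+ (g.+1.-1 - v) * u ^+ v) gB) /=.
rewrite big_distrl /=; apply: eq_big => [v|v vg]; first by rewrite ltnS.
rewrite mulrAC mulrC; congr (_ * _); rewrite exprnP -expfzDr //; congr (_ ^ _).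
by rewrite ltnS in vg; lia.
Qed.

(** Subtracting from each column the multiple of the next one that kills the
    entry of the row of u leaves u^(l_N) in the corner.  Every other column then
    carries the factor x_i - u and a sum of geometric type, and multilinearity
    turns those sums into the sum over the interlacing signatures. *)
Lemma det_branching (F : fieldType) N (l : signature N.+1) (x : 'I_N -> F) (u : F) :
  (forall i, x i != 0) -> u != 0 ->
  \det (\matrix_(i, j) snoc x u i ^ expo l j) =
  u ^ expo l ord_max * \prod_i (x i - u) *
  \sum_(s in family (in_gap (l := l)))
     u ^+ (\sum_j s j)%N * \det (\matrix_(i, j) x i ^ expo (lower s) j).
Proof.
move=> x0 u0.
set A := (\matrix_(i, j) _).
(* Right multiplication by U performs the column operations. *)
pose U : 'M[F]_N.+1 := \matrix_(i, j)
  ((i == j)%:R - (i == j.+1 :> nat)%:R * u ^ (expo l j - expo l i)).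
have trU : is_trig_mx U.
  apply/is_trig_mxP => i j ij; rewrite !mxE.
  have /negPf-> : i != j by rewrite -val_eqE /= ltn_eqF.
  have /negPf-> : (i != j.+1 :> nat) by rewrite neq_ltn ltnS (ltnW ij).
  by rewrite mul0r subr0.
have detU : \det U = 1.
  rewrite det_trig // big1 // => i _; rewrite mxE eqxx.
  by rewrite ltn_eqF // mul0r subr0.
have AUE i (j : 'I_N) : (A *m U) i (lift ord_max j) = A i (lift ord_max j) -
    u ^ (expo l (lift ord_max j) - expo l (lift ord0 j)) * A i (lift ord0 j).
  rewrite !mxE (bigD1 (lift ord_max j)) //= (bigD1 (lift ord0 j)) /=; last first.
    by rewrite -val_eqE /= /bump /=; have := ltn_ord j; lia.
  rewrite big1 ?addr0; last first.
    move=> k /andP[k1 k2]; rewrite !mxE.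
    rewrite (negPf k1) (_ : (k == (lift ord_max j).+1 :> nat) = false) ?mul0r ?subr0 ?mulr0 //.
    by apply/negbTE; apply: contraNN k2 => /eqP kE; apply/eqP/val_inj; rewrite /= kE lift_max.
  rewrite !mxE eqxx (_ : (lift ord_max j == (lift ord_max j).+1 :> nat) = false); last by lia.
  rewrite mul0r subr0 mulr1; congr (_ + _).
  rewrite (_ : (lift ord0 j == lift ord_max j) = false); last first.
    by apply/negbTE; rewrite -val_eqE /= /bump /=; have := ltn_ord j; lia.
  rewrite (_ : (lift ord0 j == (lift ord_max j).+1 :> nat) = true); last first.
    by rewrite lift_max lift0 eqxx.
  by rewrite mul1r sub0r mulrN mulrC.
have AUm i : (A *m U) i ord_max = A i ord_max.
  rewrite !mxE (bigD1 ord_max) //= big1 ?addr0; last first.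
    move=> k k1; rewrite !mxE (negPf k1) (_ : (k == (ord_max : 'I_N.+1).+1 :> nat) = false) ?mul0r ?subr0 ?mulr0 //.
    by have := ltn_ord k; rewrite /=; lia.
  rewrite !mxE eqxx (_ : ((ord_max : 'I_N.+1) == (ord_max : 'I_N.+1).+1 :> nat) = false); last by lia.
  by rewrite mul0r subr0 mulr1.
have -> : \det A = \det (A *m U) by rewrite det_mulmx detU mulr1.
rewrite (expand_det_row _ ord_max) (bigD1 ord_max) //= big1 ?addr0; last first.
  move=> j; case: (unliftP ord_max j) => [k ->|->]; last by rewrite eqxx.
  by rewrite AUE !mxE !snoc_max -expfzDr // subrK subrr mul0r.
rewrite AUm !mxE snoc_max /cofactor addnn -signr_odd odd_double expr0 mul1r -mulrA; congr (_ * _).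
have gapb j : (gap l j < gap_bound l)%N by rewrite ltnS leq_bigmax.
have expgap (j : 'I_N) : expo l (lift ord_max j) = expo l (lift ord0 j) + (gap l j)%:Z + 1.
  rewrite /expo gapE lift_max lift0; have := ltn_ord j; lia.
transitivity (\det (\matrix_(i, j) ((x i - u) *
    \sum_(v | in_gap (l := l) j v) u ^+ v * x i ^ (expo l (lift ord_max j) - 1 - v%:Z)))).
  congr (\det _); apply/matrixP => i j; rewrite 2![LHS]mxE AUE !mxE !snoc_lift [LHS]/=.
  rewrite expgap (_ : expo _ _ + _ + 1 - expo _ _ = (gap l j).+1%:Z); last by lia.
  rewrite (exprz_diff_sum _ _ (x0 i) (gapb j)); congr (_ * _).
  by apply: eq_bigr => v _; congr (_ * _ ^ _); lia.
transitivity (\det (diag_mx (\row_i (x i - u)) *m (\matrix_(i, j)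
    \sum_(v | in_gap (l := l) j v) u ^+ v * x i ^ (expo l (lift ord_max j) - 1 - v%:Z)))).
  by congr (\det _); apply/matrixP => i j; rewrite mul_diag_mx !mxE.
rewrite det_mulmx det_diag; congr (_ * _); first by apply: eq_bigr => i _; rewrite !mxE.
rewrite det_sum_col; apply: eq_bigr => s sQ.
transitivity (\det ((\matrix_(i, j) x i ^ expo (lower s) j) *m diag_mx (\row_j u ^+ s j))).
  congr (\det _); apply/matrixP => i j; rewrite mul_mx_diag !mxE mulrC; congr (_ ^ _ * _).
  rewrite /expo lowerE // lift_max; have := ltn_ord j.
  move: (val l (lift ord_max j)) (nat_of_ord (s j)) => a b; lia.
rewrite det_mulmx det_diag mulrC; congr (_ * _).
by rewrite expr_sum; apply: eq_bigr => i _; rewrite !mxE.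
Qed.

Definition vdm (F : fieldType) N (x : 'I_N -> F) : F :=
  \prod_(i < N) \prod_(j < N | (i < j)%N) (x i - x j).

Lemma vdm_neq0 (F : fieldType) N (x : 'I_N -> F) : injective x -> vdm x != 0.
Proof.
move=> xi; apply/prodf_neq0 => i _; apply/prodf_neq0 => j ij.
by rewrite subr_eq0; apply/eqP => /xi eij; rewrite eij ltnn in ij.
Qed.

Lemma vdm_snoc (F : fieldType) N (x : 'I_N -> F) (u : F) :
  vdm (snoc x u) = vdm x * \prod_i (x i - u).
Proof.
have wl i : widen_ord (leqnSn N) i = lift ord_max i.
  by apply: val_inj => /=; rewrite /bump; have := ltn_ord i; lia.
rewrite /vdm big_ord_recr /= [X in _ * X]big_pred0 ?mulr1; last first.
  by move=> j /=; have := ltn_ord j; lia.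
rewrite -big_split /=; apply: eq_bigr => i _.
rewrite big_mkcond big_ord_recr /= ltn_ord snoc_max wl snoc_lift -big_mkcond /=.
by congr (_ * _); apply: eq_bigr => j _; rewrite wl snoc_lift.
Qed.

Lemma snoc_inj T N (x : 'I_N -> T) u : injective (snoc x u) ->
  injective x /\ forall i, x i <> u.
Proof.
move=> xi; split=> [i j xij|i xiu].
  by apply: (@lift_inj _ ord_max); apply: xi; rewrite !snoc_lift.
have /xi/eqP : snoc x u (lift ord_max i) = snoc x u ord_max.
  by rewrite snoc_lift snoc_max.
by rewrite eq_sym (negPf (neq_lift _ _)).
Qed.

(** The branching rule of Schur functions, in the Laurent setting. *)
Lemma schur_branching (F : fieldType) N (l : signature N.+1) (x : 'I_N -> F) (u : F) :
  (forall i, x i != 0) -> u != 0 -> injective (snoc x u) ->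
  schur l (snoc x u) =
  \sum_(s in family (in_gap (l := l)))
     u ^ (val l ord_max + (\sum_j s j)%N%:Z) * schur (lower s) x.
Proof.
move=> x0 u0 xi; have [xi1 xu] := snoc_inj xi.
rewrite /schur -/(vdm _) det_branching // vdm_snoc.
rewrite (_ : expo l ord_max = val l ord_max); last by rewrite /expo subnn addr0.
have p0 : \prod_i (x i - u) != 0.
  by apply/prodf_neq0 => i _; rewrite subr_eq0; apply/eqP.
have v0 := vdm_neq0 xi1.
transitivity (u ^ val l ord_max * (\sum_(s in family (in_gap (l := l)))
     u ^+ (\sum_j s j)%N * \det (\matrix_(i, j) x i ^ expo (lower s) j)) / vdm x).
  by field; rewrite v0.
rewrite -mulrA mulr_suml mulr_sumr; apply: eq_bigr => s _.
by rewrite expfzDr // exprnP !mulrA.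
Qed.

(** * Linear independence of Schur functions *)

Lemma max_on_seq (T : eqType) (f : T -> int) (r : seq T) (x0 : T) : x0 \in r ->
  exists2 x, x \in r & forall y, y \in r -> f y <= f x.
Proof.
elim: r x0 => // a [|b r] IH x0 _.
  by exists a => [|y]; rewrite ?mem_head // inE => /eqP ->.
have [x xr xm] := IH b (mem_head _ _).
have [ax|xa] := leP (f a) (f x).
  exists x => [|y]; first by rewrite inE xr orbT.
  by rewrite inE => /orP[/eqP -> //|]; apply: xm.
exists a => [|y]; first exact: mem_head.
by rewrite inE => /orP[/eqP -> //|/xm/le_trans]; apply; apply: ltW.
Qed.

(** As z grows, the term of largest exponent cannot be balanced by the others. *)
Lemma dominant_coef (R : realFieldType) (T : eqType) (r : seq T) (c : T -> R)
    (E : T -> int) (a0 : T) (z0 : R) :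
  uniq r -> a0 \in r ->
  (forall a, a \in r -> a != a0 -> c a != 0 -> E a < E a0) ->
  (forall z, z0 < z -> \sum_(a <- r) c a * z ^ E a = 0) -> c a0 = 0.
Proof.
move=> ur ra0 Elt vanish; apply/eqP/negPn/negP => c0.
pose S := \sum_(a <- r | a != a0) `|c a|.
pose z := Num.max z0 1 + S / `|c a0| + 1.
have nc0 : 0 < `|c a0| by rewrite normr_gt0.
have S0 : 0 <= S by apply: sumr_ge0.
have Sc0 : 0 <= S / `|c a0| by rewrite divr_ge0.
have max0 : z0 <= Num.max z0 1 by rewrite le_max lexx.
have max1 : 1 <= Num.max z0 1 by rewrite le_max lexx orbT.
have [z0z z1 Sz] : [/\ z0 < z, 1 <= z & S / `|c a0| < z].
  rewrite /z; move: max0 max1 Sc0; move: (Num.max _ _) (S / _) => a b *.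
  by split; lra.
have zp : 0 < z by apply: lt_le_trans z1.
have := vanish _ z0z; rewrite (bigD1_seq a0) //= => /eqP.
rewrite addr_eq0 => /eqP ce.
have : `|c a0 * z ^ E a0| <= S * z ^ (E a0 - 1).
  rewrite ce normrN (le_trans (ler_norm_sum _ _ _)) // mulr_suml.
  rewrite big_seq_cond [leRHS]big_seq_cond ler_sum // => a /andP[ar aa0].
  have [-> |ca0] := eqVneq (c a) 0; first by rewrite mul0r !normr0 mul0r.
  rewrite normrM ler_wpM2l // ger0_norm ?(exprz_ge0 _ (ltW zp)) //.
  by apply: (ler_weXz2l z1); rewrite lerBrDr lezD1; apply: Elt.
rewrite normrM (ger0_norm (exprz_ge0 _ (ltW zp))).
have -> : z ^ E a0 = z * z ^ (E a0 - 1).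
  by rewrite -[X in X * _]expr1z -expfzDr ?gt_eqF // addrC subrK.
rewrite mulrA ler_pM2r ?exprz_gt0 // leNgt => /negP; apply.
by rewrite -ltr_pdivrMl // mulrC.
Qed.

Lemma increasing_perm N (w : 'S_N) :
  (forall i j : 'I_N, (i < j)%N -> (w i < w j)%N) -> w = 1%g.
Proof.
have key (v : 'S_N) : (forall i j : 'I_N, (i < j)%N -> (v i < v j)%N) ->
    forall i : 'I_N, (i <= v i)%N.
  move=> vi [i iN]; elim: i iN => // k IH kN.
  exact: leq_ltn_trans (IH (ltnW kN)) (vi (Ordinal (ltnW kN)) (Ordinal kN) (leqnn _)).
move=> wi; apply/permP => i; rewrite perm1; apply/val_inj/eqP => /=.
rewrite eqn_leq (key w wi) andbT.
have wVi (a b : 'I_N) : (a < b)%N -> (w^-1%g a < w^-1%g b)%N.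
  move=> ab; rewrite ltnNge leq_eqVlt negb_or; apply/andP; split.
    by apply: contraTN ab => /eqP/val_inj/perm_inj ->; rewrite ltnn.
  by apply: contraTN ab => /wi; rewrite !permKV -leqNgt => /ltnW.
by have := key _ wVi (w i); rewrite permK.
Qed.

Lemma expo_perm N (m m' : signature N) (w : 'S_N) :
  (forall i, expo m' i = expo m (w i)) -> m = m' /\ w = 1%g.
Proof.
move=> e; have w1 : w = 1%g.
  apply: increasing_perm => i j /(expo_lt m'); rewrite !e => lt_e.
  rewrite ltnNge leq_eqVlt negb_or; apply/andP; split.
    by apply: contraTN lt_e => /eqP/val_inj ->; rewrite ltxx.
  by apply: contraTN lt_e => /(expo_lt m)/ltW; rewrite leNgt.
split=> //; apply/val_inj/ffunP => i.
by have := e i; rewrite w1 perm1 /expo => /addIr.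
Qed.

(** Evaluated at x_i = z^(n_i), the numerator of s_m is a signed sum of
    z^<n, w e> over the permutations w, where e is the exponent vector of m.
    Let n be the exponent vector of largest norm in the support.  By
    Cauchy-Schwarz <n, n> is attained only at e = n and w = 1, so the
    coefficient at this vector vanishes.  This gives the uniqueness of the link
    coefficients, which [get] needs. *)
Lemma schur_free (R : realFieldType) N (u : R) (r : seq (signature N)) (c : signature N -> R) :
  u != 0 -> (0 < N)%N ==> (u != 1) -> uniq r ->
  (forall x : 'I_N -> R, (forall i, x i != 0) -> injective (snoc x u) ->
     \sum_(m <- r) c m * schur m x = 0) ->
  forall m, m \in r -> c m = 0.
Proof.
move=> u0 u1 ur vanish m0 m0r; apply/eqP/negPn/negP => cm0.
pose nrm (m : signature N) : int := \sum_i expo m i ^+ 2.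
have [|ms msr msmax] := @max_on_seq _ nrm [seq m <- r | c m != 0] m0.
  by rewrite mem_filter cm0.
move: msr; rewrite mem_filter => /andP[/negP cms msr]; apply: cms; apply/eqP.
pose rr := [seq (m, w) | m <- r, w <- index_enum {perm 'I_N}].
pose cc (a : signature N * 'S_N) : R := c a.1 * (-1) ^+ (a.2 : 'S_N).
pose E (a : signature N * 'S_N) : int := \sum_i expo ms i * expo a.1 (a.2 i).
suff : cc (ms, 1%g) = 0 by rewrite /cc /= odd_perm1 expr0 mulr1.
apply: (@dominant_coef R _ rr cc E _ (Num.max u (Num.max u^-1 1))).
- by rewrite allpairs_uniq ?index_enum_uniq // => -[? ?] [? ?].
- by apply/allpairsP; exists (ms, 1%g); split; rewrite ?mem_index_enum.
- move=> [m w] /allpairsP[[m' w'] /= [m'r _ [-> ->]]] {m w} ne; rewrite /cc /= => cne.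
  have cm' : c m' != 0 by apply: contraNneq cne => ->; rewrite mul0r.
  have : nrm m' <= nrm ms by apply: msmax; rewrite mem_filter cm'.
  have -> : nrm m' = \sum_i expo m' (w' i) ^+ 2 by rewrite /nrm (reindex_inj (@perm_inj _ w')).
  have -> : E (ms, 1%g) = nrm ms by rewrite /E /nrm; apply: eq_bigr => i _; rewrite perm1 expr2.
  move=> le_nrm; rewrite ltNge; apply: contraNN ne => le_E.
  have : \sum_i (expo ms i - expo m' (w' i)) ^+ 2 <= 0.
    under eq_bigr => i _ do rewrite sqrrB.
    rewrite big_split sumrB /= sumrMnl -/(nrm ms).
    move: le_nrm le_E; rewrite /E /=.
    move: (nrm ms) (\sum_i _) (\sum_(i < N) expo m' _ ^+ 2); clear=> a b d; lia.
  move=> sum_le0.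
  have sum0 : \sum_i (expo ms i - expo m' (w' i)) ^+ 2 = 0.
    by apply/eqP; rewrite eq_le sum_le0 sumr_ge0 // => i _; exact: sqr_ge0.
  have all0 := psumr_eq0P (fun i _ => sqr_ge0 _) sum0.
  have [|-> ->//] := @expo_perm _ m' ms w'.
  by move=> i; apply/eqP; rewrite -subr_eq0 -(sqrf_eq0 (_ - _)) all0.
(* For z above u and 1/u no power of z with nonzero exponent equals u. *)
move=> z; rewrite !gt_max => /and3P[zu zV z1].
have z0 : 0 < z by apply: lt_trans z1.
pose x i := z ^ expo ms i.
have x0 i : x i != 0 by rewrite expfz_neq0 // gt_eqF.
have xinj : injective x.
  move=> i j xij; have eij : expo ms i = expo ms j.
    by apply: (ieexprIz z0 _ xij); rewrite gt_eqF.
  have [ij|ji|/val_inj//] := ltngtP i j.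
    by have := expo_lt ms ij; rewrite eij ltxx.
  by have := expo_lt ms ji; rewrite eij ltxx.
have xu i : x i <> u.
  rewrite /x => xiu.
  have N0 : (0 < N)%N by case: (N) i {xiu} => [[]//|].
  have [e0|e0|e0] := ltgtP (expo ms i) 0.
  - have : z <= z ^ (- expo ms i).
      by rewrite -[X in X <= _]expr1z ler_eXz2l // -gtz0_ge1 oppr_gt0.
    rewrite -invr_expz xiu => /(lt_le_trans zV); by rewrite ltxx.
  - have : z <= z ^ (expo ms i).
      by rewrite -[X in X <= _]expr1z ler_eXz2l // -gtz0_ge1.
    by rewrite xiu => /(lt_le_trans zu); rewrite ltxx.
  - by move: xiu u1; rewrite e0 expr0z N0 /= => ->; rewrite eqxx.
have sinj : injective (snoc x u).
  move=> i j; case: (unliftP ord_max i) => [i' ->|->]; case: (unliftP ord_max j) => [j' ->|->]; rewrite ?snoc_lift ?snoc_max //.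
  - by move/xinj ->.
  - by move/xu.
  - by move/esym/xu.
have := vanish x x0 sinj; rewrite /schur -/(vdm _).
under eq_bigr => m _ do rewrite mulrA.
rewrite -mulr_suml => /eqP; rewrite mulf_eq0 invr_eq0 (negPf (vdm_neq0 xinj)) orbF.
move=> /eqP s0; rewrite -[RHS]s0 big_allpairs_dep /=; apply: eq_bigr => m _.
rewrite /determinant mulr_sumr; apply: eq_bigr => w _.
rewrite /cc /E /= -mulrA; congr (_ * (_ * _)).
rewrite (big_morph (fun e => z ^ e) (fun a b => expfzDr a b (lt0r_neq0 z0)) (expr0z z)).
by apply: eq_bigr => i _; rewrite mxE /x exprz_exp.
Qed.

(** * Concentration for weights on a box *)

Definition update (I J : finType) (s : {ffun I -> J}) (i : I) (v : J) : {ffun I -> J} :=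
  [ffun k => if k == i then v else s k].

(** The coordinates can be pushed to their top values one after the other: on a
    line in direction i, the weights off the top add up to at most [eps i] times
    the weight at the top. *)
Lemma box_concentration (R : realFieldType) (I J : finType) (Q : I -> pred J)
    (top : I -> J) (w : {ffun I -> J} -> R) (eps : I -> R) :
  (forall i, Q i (top i)) -> (forall i, 0 <= eps i) ->
  (forall i s, s \in family Q ->
     \sum_(v | Q i v) w (update s i v) <= (1 + eps i) * w (update s i (top i))) ->
  forall D : seq I, uniq D ->
  \sum_(s in family Q) w s <= \prod_(i <- D) (1 + eps i) *
    \sum_(s in family Q | all (fun i => s i == top i) D) w s.
Proof.
move=> Qtop eps0 step; elim=> [_|i D IH /= /andP[iD uD]].
  by rewrite big_nil mul1r; under [X in _ <= X]eq_bigl do rewrite andbT.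
apply: le_trans (IH uD) _; rewrite big_cons [X in _ <= X * _]mulrC -mulrA.
rewrite ler_wpM2l //; first by apply: prodr_ge0 => k _; rewrite addr_ge0.
rewrite (partition_big (fun s => update s i (top i))
  (fun s => (s \in family Q) && ((s i == top i) && all (fun k => s k == top k) D))) /=; last first.
  move=> s /andP[sQ sD]; rewrite ffunE !eqxx /=; apply/andP; split.
    by apply/familyP => k; rewrite ffunE; case: (k =P i) => [->|_]; [exact: Qtop|exact: (familyP sQ)].
  apply/allP => k kD; rewrite ffunE; case: (k =P i) => [->|_]; [exact: eqxx|by move: sD => /allP/(_ k kD)].
rewrite mulr_sumr ler_sum // => s /andP[sQ /andP[/eqP si sD]].
have update_id : update s i (top i) = s.
  by apply/ffunP => k; rewrite ffunE; case: (k =P i) => [->|].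
have := step i s sQ; rewrite update_id; apply: le_trans.
rewrite (reindex_onto (fun v => update s i v) (fun s' => s' i)) /=; last first.
  move=> s' /andP[_ /eqP <-]; apply/ffunP => k; rewrite !ffunE.
  by case: (k =P i) => [->|].
rewrite le_eqVlt; apply/orP; left; apply/eqP; apply: eq_bigl => v.
rewrite !ffunE eqxx eqxx andbT; apply/idP/idP.
  by move=> /andP[/andP[/familyP/(_ i)]]; rewrite ffunE eqxx.
move=> Qv; apply/andP; split.
  apply/andP; split.
    by apply/familyP => k; rewrite ffunE; case: (k =P i) => [->|_] //; exact: (familyP sQ).
  apply/allP => k kD; rewrite ffunE; case: (k =P i) => [ki|_]; last by move: sD => /allP/(_ k kD).
  by move: iD; rewrite -ki kD.
by apply/eqP/ffunP => k; rewrite !ffunE; case: (k =P i) => [->|].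
Qed.

Section Geometric.
Variables (R : realType) (q : R).
Hypothesis hq : 0 < q < 1.

Let q0 : 0 < q. Proof. by have /andP[] := hq. Qed.
Let q1 : q < 1. Proof. by have /andP[] := hq. Qed.
Let q1' : 0 < 1 - q. Proof. by rewrite subr_gt0. Qed.

Lemma geo_tail (g B : nat) :
  \sum_(m < B | (g <= m)%N) q ^+ m <= q ^+ g / (1 - q).
Proof.
suff : \sum_(m < B | (g <= m)%N) q ^+ m * (1 - q) <= q ^+ g - q ^+ maxn B g.
  rewrite -mulr_suml => h; rewrite ler_pdivlMr // (le_trans h) //.
  by rewrite gerBl exprn_ge0 // ltW.
elim: B => [|B IH]; first by rewrite big_ord0 max0n subrr.
rewrite big_mkcond big_ord_recr /= -big_mkcond /=.
case: leqP => gB.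
  move: IH; rewrite (maxn_idPl gB) (maxn_idPl (leqW gB)) exprS => IH.
  rewrite mulrBr mulr1 [_ * q]mulrC.
  by move: IH; move: (\sum_(_ < _ | _) _) => S; lra.
by move: IH; rewrite addr0 (maxn_idPr gB) (maxn_idPr (ltnW gB)).
Qed.

Lemma geo_sum_inj (I : finType) (P : pred I) (h : I -> nat) (g : nat) :
  {in P &, injective h} -> (forall i, P i -> (g <= h i)%N) ->
  \sum_(i | P i) q ^+ h i <= q ^+ g / (1 - q).
Proof.
move=> hI hg; pose B := (\max_i h i).+1.
have hB i : (h i < B)%N by rewrite ltnS leq_bigmax.
apply: le_trans (geo_tail g B).
rewrite (partition_big (fun i => Ordinal (hB i)) (fun m : 'I_B => (g <= m)%N)) /=; last by move=> i /hg.
rewrite ler_sum // => m gm.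
have [i /andP[Pi /eqP im]|none] := pickP (fun i => P i && (Ordinal (hB i) == m)).
  rewrite (bigD1 i) /=; last by rewrite Pi im eqxx.
  rewrite big1 ?addr0; first by rewrite -im.
  move=> k /andP[/andP[Pk /eqP km] /eqP[]]; apply: hI => //.
  by have := congr1 val km; rewrite /= -im.
by rewrite big_pred0 // exprn_ge0 // ltW.
Qed.

(** A bound for the inverse of the infinite product of the 1 - q^m. *)
Definition poch_bound : R := expR (1 / (1 - q) / (1 - q)).

Lemma prod_inv_bound (I : finType) (P : pred I) (h : I -> nat) :
  {in P &, injective h} -> (forall i, P i -> (0 < h i)%N) ->
  \prod_(i | P i) (1 - q ^+ h i)^-1 <= poch_bound.
Proof.
move=> hI h0; have hq1 i : P i -> q ^+ h i <= q.
  move=> /h0; case: (h i) => // n _; by rewrite exprS ler_piMr ?exprn_ile1 // ltW.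
apply: (@le_trans _ _ (\prod_(i | P i) expR (q ^+ h i / (1 - q)))).
  apply: ler_prod => i Pi; have := hq1 i Pi => qh.
  have lt_q1 := q1; have d0 : 0 < 1 - q ^+ h i by lra.
  rewrite invr_ge0 ltW //=; apply: le_trans (expR_ge1Dx _).
  have qp : 0 <= q ^+ h i by rewrite exprn_ge0 // ltW.
  have -> : (1 - q ^+ h i)^-1 = 1 + q ^+ h i / (1 - q ^+ h i) by field; lra.
  by rewrite lerD2l ler_wpM2l // lef_pV2 ?posrE //; lra.
rewrite -expR_sum ler_expR -mulr_suml ler_wpM2r // ?invr_ge0 ?(ltW q1') //.
by have := geo_sum_inj (g := 0) hI; rewrite expr0; apply.
Qed.

Lemma pair_bound (a b u : R) : b <= a * u -> 0 <= a -> u < 1 -> a <= (a - b) / (1 - u).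
Proof. by move=> bau a0 u1; rewrite ler_pdivlMr; nra. Qed.

(** The values y are those of t^e at the shifted coordinates e of a signature.
    Multiplying y_c by rho enlarges only the differences with the smaller
    values; those are controlled by y_c alone because the values decay at least
    geometrically in the distance of the indices. *)
Lemma vdm_ratio N (y y' : 'I_N -> R) (c : 'I_N) (P : pred 'I_N) (h : 'I_N -> nat) (rho : R)
    (G : 'I_N -> R) :
  (forall i, 0 < y i) -> 1 <= rho -> y' c = y c * rho ->
  (forall i, i != c -> y' i = y i) ->
  (forall i, P i -> (0 < h i)%N /\ y i <= y c * q ^+ h i) ->
  (forall i, i != c -> ~~ P i -> y' c <= y i) ->
  (forall k, G k = if P k then rho / (1 - q ^+ h k) else 1) ->
  \prod_(i < N) \prod_(j < N | (i < j)%N) `|y' j - y' i| <=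
  (\prod_(i < N) \prod_(j < N | (i < j)%N) `|y j - y i|) *
  ((\prod_(k < N | (k < c)%N) G k) * (\prod_(k < N | (c < k)%N) G k)).
Proof.
move=> y0 rho1 yc yE yP ynP GE.
have yc0 := y0 c.
have key k : k != c -> `|y' c - y' k| <= `|y c - y k| * G k.
  move=> kc; rewrite (yE k kc) GE; case: ifP => [Pk|/negbT nPk].
    have [hk yk] := yP k Pk.
    have qh : q ^+ h k < 1 by rewrite exprn_ilt1 ?q1 ?(ltW q0) // -lt0n.
    have qh0 : 0 < q ^+ h k by rewrite exprn_gt0 // q0.
    have yk0 := y0 k.
    have ykc : y k <= y c by nra.
    rewrite yc !ger0_norm ?subr_ge0 //; last by nra.
    rewrite [rho / _]mulrC mulrA [leRHS]mulrC.
    have := pair_bound yk (ltW yc0) qh; move: (_ / _) => z; nra.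
  have := ynP k kc nPk; rewrite yc => yk; rewrite mulr1 !ler0_norm ?subr_le0 //; nra.
have ->: (\prod_(k < N | (k < c)%N) G k) * (\prod_(k < N | (c < k)%N) G k) =
   \prod_(i < N) \prod_(j < N | (i < j)%N)
     ((if j == c then G i else 1) * (if i == c then G j else 1)).
  under [RHS]eq_bigr => i _ do rewrite big_split /=.
  rewrite big_split /=; congr (_ * _).
    rewrite [LHS]big_mkcond; apply: eq_bigr => i _; rewrite -big_mkcondr /=.
    case: ltnP => ic; last first.
      by rewrite big_pred0 // => j; case: eqP => [->|_]; rewrite ?andbF // andbT ltnNge ic.
    by rewrite (big_pred1 c) // => j /=; case: eqP => [->|_]; rewrite ?andbF ?ic.
  rewrite [RHS](bigD1 c) //= eqxx [X in _ * X]big1 ?mulr1 // => i /negPf ->.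
  by rewrite big1.
rewrite -big_split /=; apply: ler_prod => i _.
rewrite prodr_ge0 //= -big_split /=; apply: ler_prod => j ij.
rewrite normr_ge0 /=; case: (j =P c) => [jc|/eqP jc].
  have ic : i != c by apply: contraTneq ij => ->; rewrite jc ltnn.
  by rewrite (negPf ic) mulr1 jc; apply: key.
case: (i =P c) => [ic|/eqP ic]; last by rewrite !mulr1 !yE.
by rewrite mul1r ic distrC [X in _ <= X * _]distrC; apply: key.
Qed.

End Geometric.

(** * The weights of the links *)

(** The weight of the step l -> [lower s], up to a factor that depends on l
    only: the power of the new variable times the numerator of the principal
    specialization of the lower signature. *)
Definition weight (R : realType) (t : R) N (l : signature N.+1)
    (s : {ffun 'I_N -> 'I_(gap_bound l)}) : R :=
  t ^+ (N * \sum_j s j)%N *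
  \prod_(i < N) \prod_(j < N | (i < j)%N)
     `|t ^ expo (lower s) j - t ^ expo (lower s) i|.

Lemma sum_update (I : finType) (B : nat) (s : {ffun I -> 'I_B}) (c : I) (v w : 'I_B) :
  (\sum_j update s c v j + w = \sum_j update s c w j + v)%N.
Proof.
rewrite (bigD1 c) //= [in RHS](bigD1 c) //= !ffunE eqxx.
rewrite addnAC [RHS]addnAC (addnC (v : nat)); congr (_ + _)%N.
by apply: eq_bigr => j /negPf jc; rewrite !ffunE jc.
Qed.

Lemma family_update N (l : signature N.+1) (s : {ffun 'I_N -> 'I_(gap_bound l)}) c v :
  s \in family (in_gap (l := l)) -> in_gap c v ->
  update s c v \in family (in_gap (l := l)).
Proof.
move=> sQ vQ; apply/familyP => k; rewrite ffunE; case: (k =P c) => [->|_] //.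
exact: (familyP sQ).
Qed.

Lemma expo_gap N (m : signature N) (i j : 'I_N) :
  (i <= j)%N -> expo m j + (j - i)%N%:Z <= expo m i.
Proof.
move=> ij; have := signature_le m ij; rewrite /expo.
have := ltn_ord j; move: (val m i) (val m j) => a b; lia.
Qed.

Lemma expo_update N (l : signature N.+1) (s : {ffun 'I_N -> 'I_(gap_bound l)}) c v w k :
  s \in family (in_gap (l := l)) -> in_gap c v -> in_gap c w ->
  expo (lower (update s c v)) k =
  if k == c then expo (lower (update s c w)) k + w%:Z - v%:Z else expo (lower (update s c w)) k.
Proof.
move=> sQ vQ wQ; rewrite /expo !lowerE ?family_update // !ffunE; case: eqP => // _.
move: (val l _) (N - k.+1)%N (nat_of_ord v) (nat_of_ord w) => a b c' d; lia.
Qed.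

Section Weights.
Variables (R : realType) (q : R).
Hypothesis hq : 0 < q < 1.

Let q0 : 0 < q. Proof. by have /andP[] := hq. Qed.
Let q1 : q < 1. Proof. by have /andP[] := hq. Qed.
Let q1' : 0 < 1 - q. Proof. by rewrite subr_gt0. Qed.

Lemma weight_ge0 (t : R) N (l : signature N.+1) s : 0 <= t -> 0 <= weight t (l := l) s.
Proof.
move=> t0; apply: mulr_ge0; first exact: exprn_ge0.
by apply: prodr_ge0 => i _; apply: prodr_ge0 => j _.
Qed.

Lemma powz_anti (e e' : int) : e <= e' -> q ^ e' <= q ^ e.
Proof.
move=> ee; have [n ->] : exists n : nat, e' = e + n%:Z.
  by exists `|e' - e|%N; rewrite gez0_abs ?subr_ge0 // addrCA subrr addr0.
rewrite expfzDr ?gt_eqF // ler_piMr ?exprz_ge0 ?(ltW q0) //.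
by rewrite exprn_ile1 ?(ltW q0) ?(ltW q1).
Qed.

Lemma prod_lt_const N (c : 'I_N) (x : R) : \prod_(k < N | (k < c)%N) x = x ^+ c.
Proof. by rewrite (big_ord_narrow (ltnW (ltn_ord c))) prodr_const card_ord. Qed.

Lemma prod_gt_const N (c : 'I_N) (x : R) : \prod_(k < N | (c < k)%N) x = x ^+ (N - c.+1).
Proof.
rewrite (reindex_inj rev_ord_inj) /= -[(N - c.+1)%N]/(rev_ord c : nat) -prod_lt_const.
by apply: eq_bigl => k /=; have := ltn_ord k; have := ltn_ord c; lia.
Qed.

(** In base q the displacement v of coordinate c contributes q^(N v) from the new
    variable and, up to a bounded factor, q^(- c v) from the pairs that it forms
    with earlier coordinates. *)
Lemma weight_plus N (l : signature N.+1) s c v :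
  s \in family (in_gap (l := l)) -> in_gap c v ->
  weight q (update s c v) <= poch_bound q * q ^+ ((N - c) * v)%N * weight q (update s c ord0).
Proof.
move=> sQ vQ; have Q0 : in_gap (l := l) c ord0 by [].
have yE k := expo_update k sQ vQ Q0.
have posq e : 0 < q ^ e by rewrite exprz_gt0.
have qv0 : 0 < q ^+ v by rewrite exprn_gt0.
rewrite /weight.
set Y := (X in _ * X <= _); set Y0 := (X in _ <= _ * (_ * X)).
have Y0ge : 0 <= Y0 by apply: prodr_ge0 => i _; apply: prodr_ge0 => j _.
pose G (k : 'I_N) := if (k < c)%N then (q ^+ v)^-1 / (1 - q ^+ (c - k)) else 1.
have VR : Y <= Y0 * (((q ^+ v)^-1) ^+ c * poch_bound q).
  apply: le_trans (@vdm_ratio R q hq N (fun k => q ^ expo (lower (update s c ord0)) k)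
    (fun k => q ^ expo (lower (update s c v)) k) c (fun k => (k < c)%N) (fun k => (c - k)%N)
    (q ^+ v)^-1 G _ _ _ _ _ _ _) _ => //.
  - by rewrite invf_ge1 // exprn_ile1 ?(ltW q1) ?(ltW q0).
  - by rewrite yE eqxx /= addr0 expfzDr ?gt_eqF // exprnN.
  - by move=> i ic; rewrite yE (negPf ic).
  - move=> i ic; rewrite subn_gt0; split => //.
    rewrite exprnP -expfzDr ?gt_eqF //; apply: powz_anti; apply: expo_gap; exact: ltnW.
  - move=> i ic; rewrite -leqNgt leq_eqVlt eq_sym => /orP[/eqP/val_inj ci|ci].
      by move: ic; rewrite ci eqxx.
    apply: powz_anti; have := ltW (expo_lt (lower (update s c v)) ci).
    by rewrite [X in X <= _]yE (negPf ic).
  - rewrite ler_wpM2l //.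
    rewrite [X in _ * X]big1 ?mulr1; last by move=> k ck; rewrite /G ltnNge ltnW.
    rewrite (eq_bigr (fun k : 'I_N => (q ^+ v)^-1 * (1 - q ^+ (c - k))^-1)); last first.
      by move=> k kc; rewrite /G kc.
    rewrite big_split /= prod_lt_const ler_wpM2l //.
      by rewrite exprn_ge0 // invr_ge0 ltW.
    apply: prod_inv_bound => //; last by move=> k /=; rewrite subn_gt0.
    move=> i j; rewrite !unfold_in => ic jc e; apply: val_inj => /=; lia.
have sE := sum_update s c v ord0.
rewrite /= addn0 in sE; rewrite sE mulnDr exprD -!mulrA.
set A := q ^+ _; have A0 : 0 <= A by rewrite exprn_ge0 // ltW.
have B0 : 0 <= q ^+ (N * v) by rewrite exprn_ge0 // ltW.
apply: le_trans (ler_wpM2l A0 (ler_wpM2l B0 VR)) _.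
have -> : (N * v = (N - c) * v + c * v)%N by rewrite -mulnDl subnK // ltnW.
have nz n : q ^+ n != 0 by rewrite expf_neq0 // gt_eqF.
rewrite exprD exprVn -exprM [(v * _)%N]mulnC.
rewrite le_eqVlt; apply/orP; left; apply/eqP.
by field; rewrite !nz.
Qed.

(** The mirror image: in base 1/q the coordinates are pulled to the lower end of
    their gaps, so the displacement is measured from there. *)
Lemma weight_minus N (l : signature N.+1) s c v :
  s \in family (in_gap (l := l)) -> in_gap c v ->
  weight q^-1 (update s c v) <= poch_bound q * q ^+ (c.+1 * (gap l c - v))%N *
    weight q^-1 (update s c (inord (gap l c))).
Proof.
move=> sQ vQ; have gB : (gap l c < gap_bound l)%N by rewrite ltnS leq_bigmax.
have topE : (inord (gap l c) : 'I_(gap_bound l)) = gap l c :> nat by rewrite inordK.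
have Q0 : in_gap (l := l) c (inord (gap l c)) by rewrite /in_gap topE.
move: (inord (gap l c)) topE Q0 => top topE Q0.
have yE k := expo_update k sQ vQ Q0.
have posq e : 0 < q ^ e by rewrite exprz_gt0.
have posq' e : 0 < q^-1 ^ e by rewrite exprz_gt0 // invr_gt0.
set r := (gap l c - v)%N.
have rE : (top = v + r :> nat)%N by rewrite topE /r subnKC.
have qr0 : 0 < q ^+ r by rewrite exprn_gt0.
rewrite /weight.
set Y := (X in _ * X <= _); set Y0 := (X in _ <= _ * (_ * X)).
have Y0ge : 0 <= Y0 by apply: prodr_ge0 => i _; apply: prodr_ge0 => j _.
pose G (k : 'I_N) := if (c < k)%N then (q ^+ r)^-1 / (1 - q ^+ (k - c)) else 1.
have VR : Y <= Y0 * (((q ^+ r)^-1) ^+ (N - c.+1) * poch_bound q).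
  apply: le_trans (@vdm_ratio R q hq N (fun k => q^-1 ^ expo (lower (update s c top)) k)
    (fun k => q^-1 ^ expo (lower (update s c v)) k) c (fun k => (c < k)%N) (fun k => (k - c)%N)
    (q ^+ r)^-1 G _ _ _ _ _ _ _) _ => //.
  - by rewrite invf_ge1 // exprn_ile1 ?(ltW q1) ?(ltW q0).
  - rewrite yE eqxx /= rE PoszD addrA addrAC addrK expfzDr ?gt_eqF ?invr_gt0 //.
    by rewrite -exprnP exprVn.
  - by move=> i ic; rewrite yE (negPf ic).
  - move=> i ic; rewrite subn_gt0; split => //.
    rewrite !exprz_inv exprnP -expfzDr ?gt_eqF //; apply: powz_anti.
    by rewrite lerNr opprD opprK lerBrDr; apply: expo_gap; exact: ltnW.
  - move=> i ic; rewrite -leqNgt leq_eqVlt => /orP[/eqP/val_inj ci|ci].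
      by move: ic; rewrite ci eqxx.
    rewrite !exprz_inv; apply: powz_anti; rewrite lerN2.
    have := ltW (expo_lt (lower (update s c v)) ci).
    by rewrite [X in _ <= X]yE (negPf ic).
  - rewrite ler_wpM2l //.
    rewrite [X in X * _]big1 ?mul1r; last by move=> k ck; rewrite /G ltnNge ltnW.
    rewrite (eq_bigr (fun k : 'I_N => (q ^+ r)^-1 * (1 - q ^+ (k - c))^-1)); last first.
      by move=> k kc; rewrite /G kc.
    rewrite big_split /= prod_gt_const ler_wpM2l //.
      by rewrite exprn_ge0 // invr_ge0 ltW.
    apply: prod_inv_bound => //; last by move=> k /=; rewrite subn_gt0.
    move=> i j; rewrite !unfold_in => ic jc e; apply: val_inj => /=; lia.
have sE := sum_update s c v top; rewrite rE in sE.
have {}sE : (\sum_j update s c top j = \sum_j update s c v j + r)%N.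
  by apply: (@addIn v); rewrite -sE [(v + r)%N]addnC addnA.
rewrite sE mulnDr exprD -!mulrA.
set A := q^-1 ^+ _; have A0 : 0 <= A by rewrite exprn_ge0 // invr_ge0 ltW.
apply: le_trans (ler_wpM2l A0 VR) _.
have -> : (N * r = c.+1 * r + (N - c.+1) * r)%N by rewrite -mulnDl subnKC.
have nz n : q ^+ n != 0 by rewrite expf_neq0 // gt_eqF.
rewrite exprD !exprVn -exprM [(r * _)%N]mulnC.
rewrite le_eqVlt; apply/orP; left; apply/eqP.
by field; rewrite !nz.
Qed.
End Weights.

Section StepMass.
Variables (R : realType) (q : R).
Hypothesis hq : 0 < q < 1.

Let q0 : 0 < q. Proof. by have /andP[] := hq. Qed.
Let q1 : q < 1. Proof. by have /andP[] := hq. Qed.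
Let q1' : 0 < 1 - q. Proof. by rewrite subr_gt0. Qed.

Definition step_const : R := poch_bound q / (1 - q) / (1 - q).

(** The coordinates in D all take their most likely value with a probability
    that is bounded below by exp(- O(q^g)), where g is the distance from D to the
    end of the block that the step removes.  The bound is positive even at
    distance 1, and its defect is summable in g. *)
Lemma step_mass (t : R) N (l : signature N.+1) (top : 'I_N -> 'I_(gap_bound l))
    (dist : 'I_N -> 'I_(gap_bound l) -> nat) (h : 'I_N -> nat) (D : pred 'I_N) (g : nat) :
  0 <= t -> (forall c, in_gap c (top c)) -> (forall c, (0 < h c)%N) ->
  (forall c s v, s \in family (in_gap (l := l)) -> in_gap c v ->
     weight t (update s c v) <=
     poch_bound q * q ^+ (h c * dist c v)%N * weight t (update s c (top c))) ->
  (forall c v, in_gap c v -> v != top c -> (0 < dist c v)%N) ->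
  (forall c, {in in_gap (l := l) c &, injective (dist c)}) ->
  {in D &, injective h} -> (forall c, D c -> (g <= h c)%N) ->
  \sum_(s in family (in_gap (l := l))) weight t s <=
  expR (step_const * q ^+ g) *
  \sum_(s in family (in_gap (l := l)) | [forall c, D c ==> (s c == top c)]) weight t s.
Proof.
move=> t0 topQ h0 step dist0 distI hI hg.
have pb0 : 0 <= poch_bound q by rewrite ltW // expR_gt0.
pose eps c := poch_bound q * (q ^+ h c / (1 - q)).
have eps0 c : 0 <= eps c.
  by rewrite mulr_ge0 // divr_ge0 ?(ltW q1') // exprn_ge0 ?(ltW q0).
have step1 c s : s \in family (in_gap (l := l)) ->
    \sum_(v | in_gap c v) weight t (update s c v) <=
    (1 + eps c) * weight t (update s c (top c)).
  move=> sQ.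
  rewrite (bigD1 (top c)) ?topQ //= mulrDl mul1r lerD2l /eps -mulrA [_ * weight _ _]mulrC.
  rewrite mulrCA; have w0 : 0 <= weight t (update s c (top c)) by apply: weight_ge0.
  apply: le_trans (_ : \sum_(v | in_gap c v && (v != top c))
     weight t (update s c (top c)) * (poch_bound q * q ^+ (h c * dist c v)) <= _).
    by apply: ler_sum => v /andP[vQ _]; rewrite mulrC; apply: step.
  rewrite -mulr_sumr ler_wpM2l // -mulr_sumr ler_wpM2l //.
  apply: geo_sum_inj => // [v w /andP[vQ _] /andP[wQ _]|v /andP[vQ vt]].
    by move/eqP; rewrite eqn_pmul2l // => /eqP; apply: distI.
  by rewrite -[X in (X <= _)%N]muln1 leq_mul2l dist0 // orbT.
apply: le_trans (box_concentration topQ eps0 step1 (enum_uniq D)) _.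
rewrite (eq_bigl (fun s => (s \in family (in_gap (l := l))) && [forall c, D c ==> (s c == top c)])); last first.
  move=> s /=; congr (_ && _); apply/allP/forallP => [a c|a c].
    by apply/implyP => Dc; apply: a; rewrite mem_enum.
  by rewrite mem_enum => Dc; have := a c; rewrite [D c]Dc.
rewrite ler_wpM2r //; first by apply: sumr_ge0 => s _; apply: weight_ge0.
rewrite big_enum /=.
apply: le_trans (_ : \prod_(c in D) expR (eps c) <= _).
  by apply: ler_prod => c _; rewrite addr_ge0 //= expR_ge1Dx.
rewrite -expR_sum ler_expR -mulr_sumr /step_const -!mulrA ler_wpM2l //.
rewrite -mulr_suml mulrC ler_wpM2l ?invr_ge0 ?(ltW q1') // mulrC.
exact: (geo_sum_inj hq (P := D)).
Qed.

Lemma step_mass_plus N (l : signature N.+1) (D : pred 'I_N) (g : nat) :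
  (forall c, D c -> (g <= N - c)%N) ->
  \sum_(s in family (in_gap (l := l))) weight q s <=
  expR (step_const * q ^+ g) *
  \sum_(s in family (in_gap (l := l)) | [forall c, D c ==> (s c == ord0)]) weight q s.
Proof.
apply: (@step_mass q N l (fun=> ord0) (fun c v => v) (fun c => N - c)%N) => //.
- exact: ltW.
- by move=> c; rewrite subn_gt0.
- by move=> c s v sQ vQ; apply: (weight_plus hq).
- by move=> c v _; rewrite -val_eqE lt0n.
- by move=> c v w _ _ /val_inj.
- move=> c c' _ _ e; apply: val_inj => /=; have := ltn_ord c; have := ltn_ord c'; lia.
Qed.

Lemma step_mass_minus N (l : signature N.+1) (D : pred 'I_N) (g : nat) :
  (forall c, D c -> (g <= c.+1)%N) ->
  \sum_(s in family (in_gap (l := l))) weight q^-1 s <=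
  expR (step_const * q ^+ g) *
  \sum_(s in family (in_gap (l := l)) |
     [forall c, D c ==> (s c == inord (gap l c))]) weight q^-1 s.
Proof.
have gB c : (gap l c < gap_bound l)%N by rewrite ltnS leq_bigmax.
apply: (@step_mass q^-1 N l (fun c => inord (gap l c)) (fun c v => gap l c - v)%N (fun c => c.+1)) => //.
- by rewrite invr_ge0 ltW.
- by move=> c; rewrite /in_gap inordK.
- by move=> c s v sQ vQ; apply: (weight_minus hq).
- move=> c v vQ vt; rewrite subn_gt0 ltn_neqAle [(v <= _)%N]vQ andbT.
  by apply: contraNN vt => /eqP vE; apply/eqP/val_inj; rewrite /= inordK.
- move=> c v w; rewrite !unfold_in => vQ wQ e; apply: val_inj => /=; lia.
- by move=> c c' _ _ [] /val_inj.
Qed.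

End StepMass.

(** * The links in closed form *)

Lemma fsum_seq (R : nmodType) (T : choiceType) (r : seq T) (f : T -> R) :
  uniq r -> (forall m, m \notin r -> f m = 0) ->
  \sum_(m \in [set: T]) f m = \sum_(m <- r) f m.
Proof.
move=> ur f0; rewrite (fsbigE r) //; last by move=> m _; apply: f0.
by apply: eq_bigl => m; rewrite in_setT.
Qed.

Lemma fsum_pushforward (R : pzSemiRingType) (T : choiceType) (I : finType) (P : pred I)
    (p : I -> R) (phi : I -> T) (f : T -> R) :
  \sum_(m \in [set: T]) (\sum_(i | P i && (phi i == m)) p i) * f m =
  \sum_(i | P i) p i * f (phi i).
Proof.
pose r := undup [seq phi i | i <- index_enum I].
have inr i : phi i \in r by rewrite mem_undup map_f // mem_index_enum.
rewrite (@fsum_seq _ _ r) ?undup_uniq //; last first.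
  move=> m mr; rewrite big_pred0 ?mul0r // => i; apply/negbTE.
  by apply: contraNN mr => /andP[_ /eqP <-].
under eq_bigr do rewrite mulr_suml.
under eq_bigr => m _ do rewrite big_mkcondr /=.
rewrite exchange_big /=; apply: eq_bigr => i _.
rewrite (bigD1_seq (phi i)) ?undup_uniq //= eqxx big1 ?addr0 // => m.
by rewrite eq_sym => /negPf ->.
Qed.

Lemma geom_snoc (F : fieldType) (t : F) N :
  @geom F t N.+1 = snoc (@geom F t N) (t ^+ N).
Proof.
apply/funext => i; case: (unliftP ord_max i) => [j ->|->].
  by rewrite snoc_lift /geom lift_max.
by rewrite snoc_max.
Qed.

Section PrincipalSpecialization.
Variables (R : realFieldType) (t : R).
Hypotheses (t0 : 0 < t) (t1 : t != 1).

Lemma geom_inj N : injective (@geom R t N).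
Proof. by move=> i j /(ieexprIn t0 t1)/val_inj. Qed.

Lemma geom_neq0 N i : @geom R t N i != 0.
Proof. by rewrite expf_neq0 // gt_eqF. Qed.

Lemma ratio_geom_gt0 N (m : signature N) (i j : 'I_N) : (i < j)%N ->
  0 < (t ^ expo m j - t ^ expo m i) / (t ^+ i - t ^+ j).
Proof.
move=> ij; have eij := expo_lt m ij.
have [t_lt1|t_gt1|tE] := ltgtP t 1; last by move: t1; rewrite tE eqxx.
  rewrite mulr_gt0 ?invr_gt0 // subr_gt0; last by rewrite ltr_iXn2l.
  have [n en] : exists n : nat, expo m i = expo m j + n.+1%:Z.
    exists `|(expo m i - (expo m j + 1))%R|%N.
    by move: eij; move: (expo m i) (expo m j); clear=> a b; lia.
  by rewrite en expfzDr ?gt_eqF // gtr_pMr ?exprz_gt0 // exprn_ilt1 // ltW.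
rewrite -mulrNN -invrN mulr_gt0 ?invr_gt0 // oppr_gt0 subr_lt0.
  by rewrite ltr_eXz2l.
by rewrite ltr_eXn2l.
Qed.

Definition geom_vdm N : R :=
  \prod_(i < N) \prod_(j < N | (i < j)%N) `|t ^+ i - t ^+ j|.

Lemma geom_vdm_gt0 N : 0 < geom_vdm N.
Proof.
apply: prodr_gt0 => i _; apply: prodr_gt0 => j ij.
rewrite normr_gt0 subr_eq0; apply: contraTneq ij => /(ieexprIn t0 t1) ->.
by rewrite ltnn.
Qed.

(** At the points 1, t, t^2, ... the numerator is a Vandermonde determinant in the
    powers t^(e_j); its factors and those of the denominator have the same sign
    for t < 1 and for t > 1. *)
Lemma schur_geom N (m : signature N) :
  schur m (@geom R t N) = (\prod_(i < N) \prod_(j < N | (i < j)%N)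
    `|t ^ expo m j - t ^ expo m i|) / geom_vdm N.
Proof.
rewrite /schur.
have -> : (\matrix_(i, j) @geom R t N i ^ (val m j + (N - j.+1)%:Z)) =
    Vandermonde N (\row_j t ^ expo m j).
  by apply/matrixP => i j; rewrite !mxE /geom -/(expo m j) !exprnP !exprz_exp mulrC.
rewrite det_Vandermonde /geom_vdm -!prodf_div; apply: eq_bigr => i _.
rewrite -!prodf_div; apply: eq_bigr => j ij; rewrite !mxE -normf_div ger0_norm //.
by rewrite ltW // ratio_geom_gt0.
Qed.

Lemma schur_geom_gt0 N (m : signature N) : 0 < schur m (@geom R t N).
Proof.
rewrite schur_geom divr_gt0 ?geom_vdm_gt0 //.
apply: prodr_gt0 => i _; apply: prodr_gt0 => j ij; rewrite normr_gt0.
by have := lt0r_neq0 (ratio_geom_gt0 m ij); rewrite mulf_eq0 negb_or => /andP[].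
Qed.

End PrincipalSpecialization.

Lemma mul_div_cancel (F : fieldType) (p x a b : F) :
  a != 0 -> b != 0 -> p * x / b = p * a / b * (x / a).
Proof. by move=> a0 b0; field; rewrite a0 b0. Qed.

Section Link.
Variables (R : realType) (q : R) (sigma : nat -> int) (N : nat).
Let t : R := q ^ sigma N.
Hypotheses (t0 : 0 < t) (t1 : t != 1).

(** The probability, under the link, that l is displaced by s. *)
Definition step_prob (u : R) n (l : signature n.+1) (s : {ffun 'I_n -> 'I_(gap_bound l)}) : R :=
  weight u s / \sum_(s' in family (in_gap (l := l))) weight u s'.

Lemma weight_schur (l : signature N.+1) (s : {ffun 'I_N -> 'I_(gap_bound l)}) :
  (t ^+ N) ^ (val l ord_max + (\sum_j s j)%N%:Z) * schur (lower s) (@geom R t N) =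
  (t ^+ N) ^ val l ord_max / geom_vdm t N * weight t s.
Proof.
rewrite expfzDr ?expf_neq0 ?gt_eqF // schur_geom // /weight -exprnP -exprM.
by rewrite [RHS]mulrACA; congr (_ * _); exact: mulrC.
Qed.

Lemma schur_geom_sum (l : signature N.+1) :
  schur l (@geom R t N.+1) = (t ^+ N) ^ val l ord_max / geom_vdm t N *
    \sum_(s in family (in_gap (l := l))) weight t s.
Proof.
rewrite geom_snoc schur_branching.
- by rewrite mulr_sumr; apply: eq_bigr => s _; rewrite weight_schur.
- by move=> i; apply: geom_neq0.
- by rewrite expf_neq0 // gt_eqF.
- by rewrite -geom_snoc; apply: geom_inj.
Qed.

Lemma step_prob_schur (l : signature N.+1) (s : {ffun 'I_N -> 'I_(gap_bound l)}) :
  step_prob t s = (t ^+ N) ^ (val l ord_max + (\sum_j s j)%N%:Z) *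
    schur (lower s) (@geom R t N) / schur l (@geom R t N.+1).
Proof.
rewrite weight_schur schur_geom_sum /step_prob.
rewrite -mulf_div divff ?mul1r // mulf_neq0 //.
  by rewrite expfz_neq0 // expf_neq0 // gt_eqF.
by rewrite invr_neq0 // gt_eqF // geom_vdm_gt0.
Qed.

(** The law given by the branching rule solves the defining equations of the
    link, and by [schur_free] they have no other solution. *)
Lemma link_step_prob (l : signature N.+1) :
  link q sigma l = fun m => \sum_(s in family (in_gap (l := l)) | lower s == m) step_prob t s.
Proof.
set c := (X in _ = X).
have cP : link_coefficients q sigma l c.
  split.
    apply: (sub_finite_set _ (finite_seq [seq lower s | s <- index_enum {ffun 'I_N -> 'I_(gap_bound l)}])).
    move=> m /=; rewrite /c; apply: contraNP => mr; apply/eqP/big_pred0 => s.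
    apply/negbTE; apply: contra_notN mr => /andP[_ /eqP <-].
    by apply/map_f; rewrite mem_index_enum.
  move=> x x0 xi; rewrite -/t in xi *.
  rewrite fsum_pushforward schur_branching ?expf_neq0 ?gt_eqF // mulr_suml.
  apply: eq_bigr => s _; rewrite step_prob_schur.
  have := lt0r_neq0 (schur_geom_gt0 t0 t1 l).
  have := lt0r_neq0 (schur_geom_gt0 t0 t1 (lower s)).
  exact: mul_div_cancel.
have [] : link_coefficients q sigma l (link q sigma l).
  by apply: (@xgetPex _ _ [set c' | link_coefficients q sigma l c']); exists c.
set d := link q sigma l => dfin dE.
have [cfin cE] := cP.
apply/funext => m.
have [r rE] : exists r : seq (signature N), [set m' | c m' != 0] `|` [set m' | d m' != 0] = [set` r].
  by apply/finite_seqP; rewrite finite_setU.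
pose r' := undup r.
have nr m' : m' \notin r' -> c m' = 0 /\ d m' = 0.
  rewrite mem_undup => mr; split; apply/eqP/negPn/negP => h; move/negP: mr; apply.
    by have : [set` r] m' by rewrite -rE; left.
  by have : [set` r] m' by rewrite -rE; right.
have [mr|/nr[-> ->]//] := boolP (m \in r').
have free := @schur_free R N (t ^+ N) r' (fun m => (d m - c m) / schur m (@geom R t N)).
apply/eqP; rewrite -subr_eq0.
have : (d m - c m) / schur m (@geom R t N) = 0.
  apply: free => //.
  - by rewrite expf_neq0 // gt_eqF.
  - apply/implyP => N0; apply: contraNneq t1 => tN.
    by rewrite -(pexpr_eq1 N0 (ltW t0)) tN.
  - exact: undup_uniq.
  move=> x x0 xi; have := dE x x0 xi; rewrite (cE x x0 xi).
  rewrite !(@fsum_seq _ _ r') ?undup_uniq //; last 2 first.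
  - by move=> m' /nr[_ ->]; rewrite mul0r.
  - by move=> m' /nr[-> _]; rewrite mul0r.
  move/eqP; rewrite eq_sym -subr_eq0 -sumrB => /eqP s0; rewrite -[RHS]s0.
  by apply: eq_bigr => m' _; rewrite -mulrBl -mulrA [_ * schur _ _]mulrC.
move/eqP; rewrite mulf_eq0 invr_eq0 => /orP[//|].
by rewrite (negPf (lt0r_neq0 (schur_geom_gt0 t0 t1 m))).
Qed.

End Link.

(** * Descending walks *)

(** Expectations are handled as positive normalized linear functionals, so that
    no summation over the signatures of intermediate levels is written out. *)
Definition is_mean (R : numDomainType) (T : Type) (phi : (T -> R) -> R) : Prop :=
  [/\ forall a f g, phi (fun x => a * f x + g x) = a * phi f + phi g,
      forall f, (forall x, 0 <= f x) -> 0 <= phi f & phi (fun=> 1) = 1].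

Section Mean.
Variables (R : numDomainType) (T : Type) (phi : (T -> R) -> R).
Hypothesis phiM : is_mean phi.

Lemma mean_lin a f g : phi (fun x => a * f x + g x) = a * phi f + phi g.
Proof. by case: phiM. Qed.

Lemma mean_cst c : phi (fun=> c) = c.
Proof.
case: phiM => lin _ one; have z : phi (fun=> 0) = 0.
  have := lin 1 (fun=> 0) (fun=> 0); rewrite mul1r addr0 mul1r.
  by move/eqP; rewrite -subr_eq0 opprD addNKr oppr_eq0 => /eqP.
by have := lin c (fun=> 1) (fun=> 0); rewrite one z !addr0 !mulr1.
Qed.

Lemma mean_le f g : (forall x, f x <= g x) -> phi f <= phi g.
Proof.
case: phiM => lin pos _ fg; rewrite -subr_ge0.
have := pos (fun x => (-1) * f x + g x); rewrite lin mulN1r addrC; apply=> x.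
by rewrite mulN1r addrC subr_ge0.
Qed.

Lemma mean_leD (f g h : T -> R) (a b : R) : (forall x, f x <= a + b * g x + h x) ->
  phi f <= a + b * phi g + phi h.
Proof.
move=> le_f; apply: (le_trans (mean_le (g := fun x => b * g x + (1 * h x + a)) _)).
  by move=> x; apply: le_trans (le_f x) _; rewrite mul1r [h x + a]addrC addrCA addrA.
by rewrite !mean_lin mean_cst mul1r [phi h + a]addrC addrCA addrA.
Qed.

Lemma mean_compl (P : pred T) :
  phi (fun x => (~~ P x)%:R) = 1 - phi (fun x => (P x)%:R).
Proof.
have := mean_lin (-1) (fun x => (P x)%:R) (fun=> 1); rewrite mean_cst mulN1r addrC => <-.
by congr phi; apply/funext => x; case: (P x); rewrite ?mulr1 ?mulr0 ?add0r ?addNr.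
Qed.

Lemma meanZ a f : phi (fun x => a * f x) = a * phi f.
Proof.
have := mean_lin a f (fun=> 0); rewrite mean_cst addr0 => <-.
by congr phi; apply/funext => x; rewrite addr0.
Qed.

Lemma mean_ge0 f : (forall x, 0 <= f x) -> 0 <= phi f.
Proof. by case: phiM => _ + _; apply. Qed.

Lemma mean_le1 f : (forall x, f x <= 1) -> phi f <= 1.
Proof. by move=> f1; rewrite -[leRHS]mean_cst; apply: mean_le. Qed.

End Mean.

Lemma mean_sum (R : numDomainType) (T : Type) (phi : (T -> R) -> R) (I : Type) (r : seq I)
    (P : pred I) (g : I -> T -> R) : is_mean phi ->
  phi (fun x => \sum_(i <- r | P i) g i x) = \sum_(i <- r | P i) phi (g i).
Proof.
move=> phiM; elim: r => [|i r IH].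
  rewrite big_nil -[RHS](mean_cst phiM); congr phi; apply/funext => x.
  by rewrite big_nil.
rewrite big_cons; case: ifP => Pi; last first.
  by rewrite -IH; congr phi; apply/funext => x; rewrite big_cons Pi.
rewrite -IH -[phi (g i)]mul1r -(mean_lin phiM); congr phi; apply/funext => x.
by rewrite big_cons Pi mul1r.
Qed.

Lemma mean_bind (R : numDomainType) (T U : Type) (phi : (T -> R) -> R)
    (psi : T -> (U -> R) -> R) :
  is_mean phi -> (forall x, is_mean (psi x)) -> is_mean (fun f => phi (fun x => psi x f)).
Proof.
move=> [lin pos one] psiM; split=> [a f g|f f0|].
- by rewrite -lin; congr phi; apply/funext => x; case: (psiM x).
- by apply: pos => x; case: (psiM x) => _ + _; apply.
- by rewrite -[RHS]one; congr phi; apply/funext => x; case: (psiM x).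
Qed.

(** Signatures of all levels in one type, so that functions and events at
    different levels have the same type whatever the expression of the level. *)
Definition state := {n : nat & signature n.+1}.

Definition st n (l : signature n.+1) : state := existT _ n l.

Section Windows.
Variable sigma : nat -> int.
Hypothesis hsigma : forall N : nat, (0 < N)%N -> sigma N = 1 \/ sigma N = -1.

Definition count_sign (s : int) (n : nat) : nat := \sum_(1 <= i < n.+1) (sigma i == s).

Lemma count_signS s n : count_sign s n.+1 = (count_sign s n + (sigma n.+1 == s))%N.
Proof. by rewrite /count_sign big_nat_recr. Qed.

Lemma count_sign_mono s m n : (m <= n)%N -> (count_sign s m <= count_sign s n)%N.
Proof.
elim: n => [|n IH]; first by rewrite leqn0 => /eqP ->.
rewrite leq_eqVlt => /orP[/eqP -> //|/IH]; rewrite count_signS; lia.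
Qed.

Lemma count_sign_total n : (count_sign (-1) n + count_sign 1 n = n)%N.
Proof.
elim: n => [|n IH]; first by rewrite /count_sign !big_nil.
rewrite !count_signS -[in RHS]IH.
by case: (hsigma (ltn0Sn n)) => -> /=; rewrite ?addn0 ?addn1 ?addnS ?addSn.
Qed.

(** The block of level j starts, inside the block of level n, after one place for
    each step of sign -1 taken between the two levels. *)
Definition window (j : nat) (x : state) : {ffun 'I_j.+1 -> int} :=
  [ffun i : 'I_j.+1 => val (tagged x)
     (inord (i + (count_sign (-1) (tag x) - count_sign (-1) j)))].

Lemma windowE j n (l : signature n.+1) i :
  window j (st l) i = val l (inord (i + (count_sign (-1) n - count_sign (-1) j))).
Proof. by rewrite ffunE. Qed.

Lemma window_inj k : injective (fun l : signature k.+1 => window k (st l)).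
Proof.
move=> l l' e; apply/val_inj/ffunP => i.
have := congr1 (fun f : {ffun 'I_k.+1 -> int} => f i) e.
by rewrite !windowE subnn addn0 inord_val.
Qed.

Lemma window_sub i j n (l l' : signature n.+1) : (i <= j)%N -> (j <= n)%N ->
  window j (st l) = window j (st l') -> window i (st l) = window i (st l').
Proof.
move=> ij jn e; apply/ffunP => a; rewrite !windowE.
have Aij := count_sign_mono (-1) ij; have Ajn := count_sign_mono (-1) jn.
have Ti := count_sign_total i; have Tj := count_sign_total j.
have Bij := count_sign_mono 1 ij.
have aj : (a + (count_sign (-1) j - count_sign (-1) i) < j.+1)%N.
  by have := ltn_ord a; move: Aij Ti Tj Bij; clear; lia.
have := congr1 (fun f : {ffun 'I_j.+1 -> int} => f (Ordinal aj)) e.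
rewrite !windowE /=.
have -> // : (a + (count_sign (-1) j - count_sign (-1) i) + (count_sign (-1) n - count_sign (-1) j) =
  a + (count_sign (-1) n - count_sign (-1) i))%N.
by move: Aij Ajn; clear; lia.
Qed.

End Windows.

Section Chain.
Variables (R : realType) (q : R) (sigma : nat -> int).
Hypothesis hq : 0 < q < 1.
Hypothesis hsigma : forall N : nat, (0 < N)%N -> sigma N = 1 \/ sigma N = -1.

Let q0 : 0 < q. Proof. by have /andP[] := hq. Qed.
Let q1 : q < 1. Proof. by have /andP[] := hq. Qed.
Let q1' : 0 < 1 - q. Proof. by rewrite subr_gt0. Qed.

Definition step n (f : signature n.+1 -> R) (l : signature n.+2) : R :=
  \sum_(s in family (in_gap (l := l))) step_prob (q ^ sigma n.+1) s * f (lower s).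

Lemma base_gt0 n : 0 < q ^ sigma n.+1.
Proof. by rewrite exprz_gt0. Qed.

Lemma base_neq1 n : q ^ sigma n.+1 != 1.
Proof.
case: (hsigma (ltn0Sn n)) => ->; first by rewrite expr1z lt_eqF.
by rewrite exprN1 gt_eqF // invf_gt1.
Qed.

Lemma step_link n (f : signature n.+1 -> R) (l : signature n.+2) :
  \sum_(m \in [set: signature n.+1]) link q sigma l m * f m = step f l.
Proof.
rewrite (link_step_prob (base_gt0 n) (base_neq1 n)).
exact: (fsum_pushforward _ _ (lower (l := l)) f).
Qed.

Lemma step_prob_ge0 n (l : signature n.+2) s : 0 <= step_prob (q ^ sigma n.+1) (l := l) s.
Proof.
rewrite divr_ge0 // ?weight_ge0 ?exprz_ge0 ?(ltW q0) //.
by apply: sumr_ge0 => s' _; rewrite weight_ge0 // exprz_ge0 ?(ltW q0).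
Qed.

Lemma sum_weight_gt0 n (l : signature n.+2) :
  0 < \sum_(s in family (in_gap (l := l))) weight (q ^ sigma n.+1) s.
Proof.
have := schur_geom_gt0 (base_gt0 n) (base_neq1 n) l.
rewrite (schur_geom_sum (base_gt0 n) (base_neq1 n)) pmulr_rgt0 // divr_gt0 //.
  by rewrite !(exprz_gt0, exprn_gt0) ?base_gt0.
exact: geom_vdm_gt0 (base_gt0 n) (base_neq1 n) _.
Qed.

Lemma step_mean n (l : signature n.+2) : is_mean (fun f => step f l).
Proof.
split=> [a f g|f f0|].
- rewrite /step mulr_sumr -big_split /=; apply: eq_bigr => s _.
  by rewrite mulrDr mulrCA.
- by apply: sumr_ge0 => s _; rewrite mulr_ge0 ?step_prob_ge0.
- rewrite /step; under eq_bigr do rewrite mulr1.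
  by rewrite -mulr_suml divff // gt_eqF // sum_weight_gt0.
Qed.

(** The expectation of f at level K for the walk that descends from a signature of
    level n >= K; as a function on all levels it is the harmonic extension of the
    restriction of f to level K.  Below level K it is f itself. *)
Fixpoint cond_mean (K : nat) (f : state -> R) (n : nat) : signature n.+1 -> R :=
  match n with
  | 0%N => fun l => f (st l)
  | n'.+1 => fun l => if (n' < K)%N then f (st l) else step (cond_mean K f (n := n')) l
  end.

Lemma cond_mean_step K f n (l : signature n.+2) : (K <= n)%N ->
  cond_mean K f l = step (cond_mean K f (n := n)) l.
Proof. by move=> Kn /=; rewrite ltnNge Kn. Qed.

Lemma cond_mean_id K f (l : signature K.+1) : cond_mean K f l = f (st l).
Proof. by case: K l => //= K l; rewrite leqnn. Qed.

Lemma cond_mean_mean K n (l : signature n.+1) : is_mean (fun f => cond_mean K f l).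
Proof.
elim: n l => [|n IH] l /=; first by split.
case: (n < K)%N; first by split.
exact: mean_bind (step_mean l) IH.
Qed.

Lemma cond_mean_tower k K f n (l : signature n.+1) : (k <= K)%N -> (K <= n)%N ->
  cond_mean k f l = cond_mean K (fun x => cond_mean k f (tagged x)) l.
Proof.
move=> kK; elim: n l => [//|n IH] l Kn /=; case: ltnP => [nk|kn].
  by rewrite (leq_trans nk kK).
case: ltnP => [//|Kn'].
congr (step _ l); apply/funext => m; exact: IH.
Qed.

Notation count_sign := (count_sign sigma).
Notation window := (window sigma).

Definition drift_const : R := step_const q / (1 - q).

(** A potential for the displacement probabilities: the step from level n+1 to
    level n costs [window j] at most drift j n - drift j n.+1, in the exponent, so
    that the costs of successive steps telescope. *)
Definition drift (j n : nat) : R := drift_const *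
  (q ^+ (count_sign (-1) n - count_sign (-1) j) + q ^+ (count_sign 1 n - count_sign 1 j)).

Lemma step_const_ge0 : 0 <= step_const q.
Proof. by rewrite !divr_ge0 ?(ltW q1') // ltW // expR_gt0. Qed.

Lemma step_event n (l : signature n.+2) (P : pred {ffun 'I_n.+1 -> 'I_(gap_bound l)})
    (f : signature n.+1 -> R) (c : R) :
  (forall m, 0 <= f m) ->
  (forall s, s \in family (in_gap (l := l)) -> P s -> f (lower s) = 1) ->
  \sum_(s in family (in_gap (l := l))) weight (q ^ sigma n.+1) s <=
  expR c * \sum_(s in family (in_gap (l := l)) | P s) weight (q ^ sigma n.+1) s ->
  expR (- c) <= step f l.
Proof.
move=> f0 f1 mass; have Z0 := sum_weight_gt0 l.
apply: le_trans (_ : \sum_(s in family (in_gap (l := l)) | P s) step_prob (q ^ sigma n.+1) s <= _).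
  rewrite /step_prob -mulr_suml ler_pdivlMr // expRN mulrC ler_pdivrMr ?expR_gt0 //.
  by rewrite mulrC.
rewrite /step big_mkcondr /= ler_sum // => s sQ; case: ifP => Ps.
  by rewrite f1 // mulr1.
by rewrite mulr_ge0 // step_prob_ge0.
Qed.

(** Let A and B count the steps of sign -1 and +1.  On the way down, the last step
    of sign +1 (resp. -1) removes a power at distance B n - B j + 1 (resp.
    A n - A j + 1) from the block of level j. *)
Lemma step_window j n (l : signature n.+2) : (j <= n)%N ->
  expR (- (drift j n - drift j n.+1)) <=
  step (fun m => (window j (st m) == window j (st l))%:R) l.
Proof.
move=> jn; pose A := count_sign (-1); pose B := count_sign 1.
have Ajn : (A j <= A n)%N := count_sign_mono sigma _ jn.
have Bjn : (B j <= B n)%N := count_sign_mono sigma _ jn.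
have Tj : (A j + B j = j)%N := count_sign_total hsigma j.
have Tn : (A n + B n = n)%N := count_sign_total hsigma n.
have sc0 := step_const_ge0.
have weaken (g : nat) : step_const q * q ^+ g.+1 <= drift j n - drift j n.+1 ->
    expR (- (drift j n - drift j n.+1)) <= expR (- (step_const q * q ^+ g.+1)).
  by move=> h; rewrite ler_expR lerN2.
have shrink (g : nat) : step_const q * q ^+ g.+1 <= drift_const * (q ^+ g - q ^+ g.+1).
  rewrite /drift_const -mulrA ler_wpM2l // exprS -{2}[q ^+ g]mul1r -mulrBl.
  by rewrite mulKf ?gt_eqF // ler_piMl ?exprn_ge0 // ltW.
have bound (i : 'I_j.+1) : (i + (A n - A j) < n.+1)%N.
  by have := ltn_ord i; move: Ajn Bjn Tj Tn; clear; lia.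
case: (hsigma (ltn0Sn n)) => sg.
- have An : A n.+1 = A n by rewrite /A count_signS sg addn0.
  have Bn : B n.+1 = (B n).+1 by rewrite /B count_signS sg eqxx addn1.
  apply: le_trans (weaken (B n - B j)%N _) _.
    rewrite /drift -/A -/B An Bn subSn // -mulrBr opprD addrACA subrr add0r.
    exact: shrink.
  pose D : pred 'I_n.+1 := fun c => (c <= j + (A n - A j))%N.
  apply: (step_event (P := fun s => [forall c, D c ==> (s c == ord0)])) => [m|s sQ|].
  + exact: ler0n.
  + move=> /forallP sD; apply/eqP; rewrite pnatr_eq1 eqb1; apply/eqP/ffunP => i.
    rewrite !windowE -/A An lowerE //.
    have Dc : D (inord (i + (A n - A j))) by rewrite /D inordK // leq_add2r -ltnS.
    have := sD (inord (i + (A n - A j))); rewrite Dc => /eqP ->.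
    rewrite subr0; congr (val l _); apply: ord_inj.
    by rewrite lift_max !inordK // ltnW // ltnS bound.
  + rewrite sg expr1z; apply: step_mass_plus => // c; rewrite /D => cD.
    by move: cD Ajn Bjn Tj Tn; clear; lia.
- have An : A n.+1 = (A n).+1 by rewrite /A count_signS sg eqxx addn1.
  have Bn : B n.+1 = B n by rewrite /B count_signS sg addn0.
  apply: le_trans (weaken (A n - A j)%N _) _.
    rewrite /drift -/A -/B An Bn subSn // -mulrBr opprD addrACA subrr addr0.
    exact: shrink.
  pose D : pred 'I_n.+1 := fun c => (A n - A j <= c)%N.
  have gB c : (gap l c < gap_bound l)%N by rewrite ltnS leq_bigmax.
  apply: (step_event (P := fun s => [forall c, D c ==> (s c == inord (gap l c))])) => [m|s sQ|].
  + exact: ler0n.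
  + move=> /forallP sD; apply/eqP; rewrite pnatr_eq1 eqb1; apply/eqP/ffunP => i.
    rewrite !windowE -/A An lowerE //.
    have Dc : D (inord (i + (A n - A j))) by rewrite /D inordK // leq_addl.
    have := sD (inord (i + (A n - A j))); rewrite Dc => /eqP ->.
    rewrite inordK // gapE opprB addrC subrK; congr (val l _); apply: ord_inj.
    by rewrite lift0 !inordK // subSn // addnS // ltnS bound.
  + by rewrite sg exprN1; apply: step_mass_minus.
Qed.

End Chain.

(** * Loss of memory *)

Lemma expr_small (R : realType) (theta e : R) : 0 <= theta < 1 -> 0 < e ->
  exists p, forall p', (p <= p')%N -> theta ^+ p' <= e.
Proof.
move=> /andP[th0 th1] e0.
have /cvgrPdist_le/(_ e e0)[p _ pP] : (fun n => theta ^+ n) @ \oo --> (0 : R).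
  by apply: cvg_expr; rewrite ger0_norm.
exists p => p' pp'; have := pP p' pp'; rewrite /= sub0r normrN ger0_norm //.
exact: exprn_ge0.
Qed.

(** One pair of positions of two independent walks: b and b' say that they have
    left the common window, c and c' that they sit at the common restriction. *)
Lemma coupling_arith (R : realFieldType) (x y rho : R) (b b' c c' : bool) :
  0 <= x <= 1 -> 0 <= y <= 1 -> 0 <= rho ->
  (~~ b -> ~~ b' -> x - y <= rho) -> (c -> c' -> x = y) ->
  x <= y + rho + b'%:R + - (rho * c'%:R) * c%:R + b%:R.
Proof.
move=> x01 y01 rho0 good same.
have b0 : 0 <= b%:R :> R by rewrite ler0n.
have b'0 : 0 <= b'%:R :> R by rewrite ler0n.
have [/andP[cT c'T]|] := boolP (c && c').
  by rewrite (same cT c'T) cT c'T /=; lra.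
have le : x <= y + rho + b'%:R + b%:R.
  case: b b' good {b0 b'0} => [] [] good /=; [lra|lra|lra|].
  by have := good isT isT; lra.
by case: c {same}; case: c' => //= _; lra.
Qed.

Section Mixing.
Variables (R : realType) (q : R) (sigma : nat -> int).
Hypothesis hq : 0 < q < 1.
Hypothesis hsigma : forall N : nat, (0 < N)%N -> sigma N = 1 \/ sigma N = -1.
Hypothesis hplus : forall m : nat, exists2 N : nat, (m <= N)%N & sigma N = 1.
Hypothesis hminus : forall m : nat, exists2 N : nat, (m <= N)%N & sigma N = -1.

Let q0 : 0 < q. Proof. by have /andP[] := hq. Qed.
Let q1 : q < 1. Proof. by have /andP[] := hq. Qed.
Let q1' : 0 < 1 - q. Proof. by rewrite subr_gt0. Qed.

Notation cond_mean K f l := (cond_mean q sigma K f l).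
Notation window := (window sigma).
Notation drift := (drift q sigma).

Let condM K n (l : signature n.+1) : is_mean (fun f => cond_mean K f l) := cond_mean_mean hq hsigma K l.

(** Only the values at level K matter, so the comparison is required there only. *)
Lemma cond_mean_leD K n (l : signature n.+1) (f g h : state -> R) (a b : R) :
  (K <= n)%N ->
  (forall m : signature K.+1, f (st m) <= a + b * g (st m) + h (st m)) ->
  cond_mean K f l <= a + b * cond_mean K g l + cond_mean K h l.
Proof.
move=> + H; elim: n l => [|n IH] l; first by rewrite leqn0 => /eqP K0; subst K; exact: H.
rewrite leq_eqVlt => /orP[/eqP Kn|Kn]; first by move: l; rewrite -Kn => l; rewrite !cond_mean_id.
rewrite !cond_mean_step //; apply: (mean_leD (step_mean hq hsigma l)) => m; exact: IH.
Qed.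

Lemma cond_mean_le K n (l : signature n.+1) (f g : state -> R) : (K <= n)%N ->
  (forall m : signature K.+1, f (st m) <= g (st m)) -> cond_mean K f l <= cond_mean K g l.
Proof.
move=> Kn fg; have := @cond_mean_leD K n l f (fun=> 0) g 0 0 Kn.
by rewrite !mul0r !add0r; apply=> m; rewrite ?mul0r ?add0r.
Qed.

Lemma drift_const_ge0 : 0 <= drift_const q.
Proof. by rewrite divr_ge0 ?step_const_ge0 // ltW. Qed.

Lemma drift_ge0 j n : 0 <= drift j n.
Proof. by rewrite mulr_ge0 ?drift_const_ge0 // addr_ge0 // exprn_ge0 // ltW. Qed.

Lemma cond_mean_window j K n (l : signature n.+1) : (j <= K)%N -> (K <= n)%N ->
  expR (- (drift j K - drift j n)) <=
  cond_mean K (fun x => (window j x == window j (st l))%:R) l.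
Proof.
move=> jK; elim: n l => [|n IH] l.
  rewrite leqn0 => /eqP K0; subst K.
  by rewrite /=  eqxx subrr oppr0 expR0.
rewrite leq_eqVlt => /orP[/eqP Kn|Kn].
  by move: l; rewrite -Kn => l; rewrite cond_mean_id eqxx subrr oppr0 expR0.
rewrite ltnS in Kn; rewrite cond_mean_step //; set f := (fun x => _).
have sM := step_mean hq hsigma l.
apply: le_trans (_ : step q sigma (fun m => expR (- (drift j K - drift j n)) *
   (window j (st m) == window j (st l))%:R) l <= _); last first.
  apply: (mean_le sM) => m; case: eqP => [wm|_].
    by rewrite mulr1; have := IH m Kn; rewrite wm.
  by rewrite mulr0; apply: (mean_ge0 (condM K m)) => x; rewrite ler0n.
rewrite (meanZ sM); apply: le_trans (ler_wpM2l _ (step_window hq hsigma l (leq_trans jK Kn))).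
  by rewrite -expRD ler_expR -opprD addrA subrK.
exact: expR_ge0.
Qed.

(** Bound for the probability that [window j] has changed on arrival at level K. *)
Definition leave_bound j K : R := 1 - expR (- drift j K).

Lemma cond_mean_leave j K n (l : signature n.+1) : (j <= K)%N -> (K <= n)%N ->
  cond_mean K (fun x => (window j x != window j (st l))%:R) l <= leave_bound j K.
Proof.
move=> jK Kn; rewrite (mean_compl (condM K l)) lerD2l lerN2.
apply: le_trans (cond_mean_window l jK Kn).
by rewrite ler_expR lerN2 gerBl drift_ge0.
Qed.

(** The value exp(- drift K K): even the whole block of level K survives with a
    probability that does not depend on K. *)
Definition stay_bound : R := expR (- (drift_const q * 2)).

Lemma cond_mean_stay K n (l : signature n.+1) : (K <= n)%N ->
  stay_bound <= cond_mean K (fun x => (window K x == window K (st l))%:R) l.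
Proof.
move=> Kn; apply: le_trans (cond_mean_window l (leqnn K) Kn).
rewrite ler_expR lerN2 [X in X - _](_ : _ = drift_const q * 2) ?gerBl ?drift_ge0 //.
by rewrite /drift !subnn !expr0.
Qed.

Lemma count_sign_unbounded (s : int) :
  (forall m : nat, exists2 N : nat, (m <= N)%N & sigma N = s) ->
  forall m, exists n0, forall n, (n0 <= n)%N -> (m <= count_sign sigma s n)%N.
Proof.
move=> hs; elim=> [|m [n0 IH]]; first by exists 0%N.
have [[//|N] nN sN] := hs n0.+1.
exists N.+1 => n Nn; apply: (leq_trans _ (count_sign_mono sigma s Nn)).
by rewrite count_signS sN eqxx addn1 ltnS IH.
Qed.

Lemma leave_bound_small j e : 0 < e ->
  exists2 K0, (j <= K0)%N & forall K, (K0 <= K)%N -> leave_bound j K <= e.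
Proof.
move=> e0; have C0 := drift_const_ge0.
have e'0 : 0 < e / 2 / (drift_const q + 1) by rewrite !divr_gt0 // ltr_wpDl.
have [|p pP] := @expr_small R q _ _ e'0; first by rewrite q1 ltW.
have [n1 n1P] := count_sign_unbounded hminus (p + count_sign sigma (-1) j).
have [n2 n2P] := count_sign_unbounded hplus (p + count_sign sigma 1 j).
exists (maxn j (maxn n1 n2)); first exact: leq_maxl.
move=> K; rewrite !geq_max => /and3P[_ K1 K2].
have : leave_bound j K <= drift j K.
  have := expR_ge1Dx (- drift j K); rewrite /leave_bound.
  by rewrite !lerBlDr [X in _ <= X -> _]addrC.
move/le_trans; apply; rewrite /drift.
have h1 : q ^+ (count_sign sigma (-1) K - count_sign sigma (-1) j) <= e / 2 / (drift_const q + 1).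
  by apply: pP; rewrite leq_subRL ?[(_ + p)%N]addnC ?n1P // (leq_trans _ (n1P K K1)) // leq_addl.
have h2 : q ^+ (count_sign sigma 1 K - count_sign sigma 1 j) <= e / 2 / (drift_const q + 1).
  by apply: pP; rewrite leq_subRL ?[(_ + p)%N]addnC ?n2P // (leq_trans _ (n2P K K2)) // leq_addl.
apply: le_trans (ler_wpM2l C0 (lerD h1 h2)) _.
rewrite -mulrDl -splitr mulrCA ler_piMr ?(ltW e0) // ler_pdivrMr ?mul1r ?lerDl //.
exact: ltr_wpDl.
Qed.

Section Oscillation.
Variables (k : nat) (f : state -> R).
Hypothesis f01 : forall x, 0 <= f x <= 1.

(** The oscillation is measured within the classes of signatures that agree on the
    block of level j, uniformly in their common level. *)
Definition oscillation_le (j : nat) (rho : R) : Prop :=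
  forall n (l l' : signature n.+1), (j <= n)%N -> window j (st l) = window j (st l') ->
    cond_mean k f l - cond_mean k f l' <= rho.

Lemma cond_mean01 n (l : signature n.+1) : 0 <= cond_mean k f l <= 1.
Proof.
apply/andP; split.
  by apply: (mean_ge0 (condM k l)) => x; have /andP[] := f01 x.
by apply: (mean_le1 (condM k l)) => x; have /andP[] := f01 x.
Qed.

(** Two independent walks from l and l' down to level K give weight at least
    [stay_bound]^2 to the pair made of twice the common restriction, where the
    values coincide, and weight at most 2 e to the pairs that do not agree on
    [window i]; on all other pairs the values differ by at most rho. *)
Lemma oscillation_contraction (i : nat) (rho e : R) : (k <= i)%N -> 0 <= rho -> 0 < e ->
  oscillation_le i rho ->
  exists2 j, (i <= j)%N & oscillation_le j ((1 - stay_bound ^+ 2) * rho + 2 * e).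
Proof.
move=> ki rho0 e0 osc_i; have [K iK Ksmall] := leave_bound_small i e0.
exists K => // n l l' Kn wK; have wi := window_sub hsigma iK Kn wK.
have kK := leq_trans ki iK.
pose F (x : state) := cond_mean k f (tagged x).
pose nu (x : state) : R := (window K x == window K (st l))%:R.
pose bad (x : state) : R := (window i x != window i (st l))%:R.
have tow (l0 : signature n.+1) : cond_mean k f l0 = cond_mean K F l0 by exact: cond_mean_tower.
have pw (m m' : signature K.+1) :
    F (st m) <= F (st m') + rho + bad (st m') + (- (rho * nu (st m'))) * nu (st m) + bad (st m).
  apply: coupling_arith => //; [exact: cond_mean01|exact: cond_mean01| |].
    by rewrite !negbK => /eqP e1 /eqP e2; apply: osc_i; rewrite // e1 e2.
  by move=> /eqP e1 /eqP e2; congr F; congr st; apply: (@window_inj sigma); rewrite e1 e2.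
have nul : stay_bound <= cond_mean K nu l := cond_mean_stay l Kn.
have nul' : stay_bound <= cond_mean K nu l' by rewrite /nu wK; exact: cond_mean_stay.
have badl : cond_mean K bad l <= e := le_trans (cond_mean_leave l iK Kn) (Ksmall K (leqnn K)).
have badl' : cond_mean K bad l' <= e.
  by rewrite /bad wi; exact: le_trans (cond_mean_leave l' iK Kn) (Ksmall K (leqnn K)).
(* Average over the first walk, the second one being at m'; then over the second. *)
have Phi (m' : signature K.+1) :
    cond_mean k f l <= F (st m') + rho + bad (st m') - rho * stay_bound * nu (st m') + e.
  rewrite tow; apply: le_trans (@cond_mean_leD K n l F nu bad _ _ Kn (fun m => pw m m')) _.
  rewrite lerD // lerD // mulNr lerN2 mulrAC ler_wpM2l //.
  by rewrite mulr_ge0 // /nu ler0n.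
have Psi : - cond_mean k f l' <= (rho + e - cond_mean k f l) + - (rho * stay_bound) * cond_mean K nu l' + cond_mean K bad l'.
  rewrite [X in - X <= _]tow -mulN1r -(meanZ (condM K l')).
  apply: (@cond_mean_leD K n l' (fun x => -1 * F x) nu bad) => // m'; rewrite mulN1r -/(F _); have := Phi m'.
  rewrite mulNr; move: (rho * _ * _) (F _) (bad _) (cond_mean k f l); move=> *; lra.
have : rho * stay_bound * stay_bound <= rho * stay_bound * cond_mean K nu l'.
  by rewrite ler_wpM2l // mulr_ge0 // expR_ge0.
move: Psi badl'; rewrite mulNr expr2 mulrBl mul1r -[_ * stay_bound * rho]mulrA [stay_bound * rho]mulrC.
rewrite [stay_bound * (_ * _)]mulrC.
move: (rho * stay_bound * stay_bound) (rho * stay_bound * _) (cond_mean K bad l') (cond_mean k f l) (cond_mean k f l').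
by move=> *; lra.
Qed.

Lemma oscillation_small e : 0 < e -> exists2 j, (k <= j)%N & oscillation_le j e.
Proof.
move=> e0; pose th := 1 - stay_bound ^+ 2.
have st0 : 0 < stay_bound by exact: expR_gt0.
have st1 : stay_bound <= 1.
  by rewrite /stay_bound -[leRHS]expR0 ler_expR oppr_le0 mulr_ge0 // drift_const_ge0.
have th01 : 0 <= th < 1.
  by rewrite subr_ge0 exprn_ile1 ?(ltW st0) //= gtrBl exprn_gt0.
have [th0 th1] := andP th01.
have e4 : 0 < e * (1 - th) / 4 by rewrite divr_gt0 // mulr_gt0 // subr_gt0.
have iter p : exists2 j, (k <= j)%N & oscillation_le j (th ^+ p + e / 2).
  elim: p => [|p [i ki osc_i]].
    exists k => // n l l' _ _; rewrite expr0.
    have := cond_mean01 l; have := cond_mean01 l'.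
    by move: (cond_mean k f l) (cond_mean k f l') e0; move=> *; lra.
  have rho0 : 0 <= th ^+ p + e / 2 by rewrite addr_ge0 ?exprn_ge0 // divr_ge0 // ltW.
  have [j ij osc_j] := oscillation_contraction ki rho0 e4 osc_i.
  exists j; first exact: leq_trans ij.
  move=> n l l' jn w; apply: le_trans (osc_j n l l' jn w) _; rewrite -/th exprS.
  by move: (th ^+ p) => z; lra.
have [|p pP] := @expr_small R th (e / 2) th01; first by rewrite divr_gt0.
have [j kj osc_j] := iter p; exists j => // n l l' jn w.
apply: le_trans (osc_j n l l' jn w) _.
by have := pP p (leqnn p); move: (th ^+ p); move=> *; lra.
Qed.

End Oscillation.

Lemma links_cond_mean d k (l : signature (d + k).+1) (m : signature k.+1) :
  links q sigma l m = cond_mean k (fun x => (window k x == window k (st m))%:R) l.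
Proof.
elim: d l => [|d IH] l.
  rewrite cond_mean_id /=; congr (nat_of_bool _)%:R.
  by apply/eqP/eqP => [->//|/(@window_inj sigma)].
rewrite [LHS]/= cond_mean_step ?leq_addl // -(step_link hq hsigma).
by apply: eq_fsbigr => n _; rewrite IH.
Qed.

End Mixing.

(** * Sums over countable sets *)

Section CountableSums.
Variables (R : realType) (T : choiceType).
Implicit Types (a b : T -> R).

Lemma esum_le_seq a (c : R) :
  (forall r : seq T, uniq r -> \sum_(l <- r) a l <= c) ->
  (\esum_(l in [set: T]) (a l)%:E <= c%:E)%E.
Proof.
move=> H; apply: ge_ereal_sup => _ [X [finX _] <-].
rewrite fsumEFin // lee_fin fsbig_finite //=.
exact: (H _ (finmap.fset_uniq _)).
Qed.

Lemma seq_le_esum a (r : seq T) : (forall l, 0 <= a l) -> uniq r ->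
  ((\sum_(l <- r) a l)%:E <= \esum_(l in [set: T]) (a l)%:E)%E.
Proof.
move=> a0 ur; apply: esum_ge; exists [set` r]; first by split.
by rewrite fsumEFin // -fsbig_seq.
Qed.

Lemma esum_seq_approx a (c e : R) : 0 < e ->
  \esum_(l in [set: T]) (a l)%:E = c%:E ->
  exists2 r : seq T, uniq r & c - e <= \sum_(l <- r) a l.
Proof.
move=> e0 sa; have [|_ [X [finX _] <-]] := @ub_ereal_sup_adherent _
   [set (\sum_(x \in A) (a x)%:E)%E | A in fsets [set: T]] e e0.
  by rewrite -/(esum _ _) sa.
rewrite -/(esum _ _) sa fsumEFin // -EFinB lte_fin fsbig_finite //= => /ltW h.
by exists (finmap.enum_fset (fset_set X)); first exact: finmap.fset_uniq.
Qed.

Lemma esum_finite_support a : (forall l, 0 <= a l) -> finite_set [set l | a l != 0] ->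
  \esum_(l in [set: T]) (a l)%:E = (\sum_(l \in [set: T]) a l)%:E.
Proof.
move=> a0 fin.
have [r rE] : exists r : seq T, [set l | a l != 0] = [set` r] by apply/finite_seqP.
have ur := undup_uniq r.
have nr l : l \notin undup r -> a l = 0.
  rewrite mem_undup => lr; apply/eqP/negPn/negP => al; move/negP: lr; apply.
  by have : [set` r] l by rewrite -rE.
rewrite (fsum_seq ur nr); apply/eqP; rewrite eq_le seq_le_esum // andbT.
apply: esum_le_seq => r' ur'.
rewrite (bigID (fun l => l \in undup r)) /= [X in _ + X]big1 ?addr0; last by move=> l /nr.
rewrite -big_filter.
have pe : perm_eq [seq l <- r' | l \in undup r] [seq l <- undup r | l \in r'].
  by apply: uniq_perm; rewrite ?filter_uniq // => l; rewrite !mem_filter andbC.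
by rewrite (perm_big _ pe) big_filter [leRHS](bigID (fun l => l \in r')) /= lerDl sumr_ge0.
Qed.

Lemma esumZ a (c : R) : 0 <= c -> (forall l, 0 <= a l) ->
  (\esum_(l in [set: T]) (c * a l)%:E = c%:E * \esum_(l in [set: T]) (a l)%:E)%E.
Proof.
move=> c0 a0; have half (d : R) (b : T -> R) : 0 <= d -> (forall l, 0 <= b l) ->
    (\esum_(l in [set: T]) (d * b l)%:E <= d%:E * \esum_(l in [set: T]) (b l)%:E)%E.
  move=> d0 b0; apply: ge_ereal_sup => _ [X [finX _] <-].
  rewrite fsumEFin // fsbig_finite //= -mulr_sumr EFinM lee_wpmul2l ?lee_fin //.
  exact: seq_le_esum (finmap.fset_uniq _).
apply/eqP; rewrite eq_le half //=.
have [cE|cN] := eqVneq c 0.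
  by rewrite cE mul0e esum_ge0 // => l _; rewrite mul0r.
have {cN}c0 : 0 < c by rewrite lt_neqAle eq_sym cN.
have := half c^-1 (fun l => c * a l); rewrite invr_ge0 (ltW c0) => /(_ isT).
have ca0 l : 0 <= c * a l by rewrite mulr_ge0 // ltW.
move=> /(_ ca0); under eq_esum => l _ do rewrite mulKf ?gt_eqF //.
move=> h; apply: (le_trans (lee_wpmul2l _ h)); first by rewrite lee_fin ltW.
by rewrite muleA -EFinM mulfV ?gt_eqF // mul1e.
Qed.

End CountableSums.

Lemma esum_exchange (R : realType) (T U : choiceType) (a : T -> U -> \bar R) :
  (forall i j, 0 <= a i j)%E ->
  (\esum_(i in [set: T]) \esum_(j in [set: U]) a i j =
   \esum_(j in [set: U]) \esum_(i in [set: T]) a i j)%E.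
Proof.
move=> a0; rewrite !esum_esum //.
rewrite (@reindex_esum _ _ _ ([set: T] `*`` (fun=> [set: U])) _ (fun x => (x.2, x.1))) //.
split => [x _ //|[x1 x2] [y1 y2] _ _ [-> ->] //|[y x] _].
by exists (x, y).
Qed.

Section Average.
Variables (R : realType) (T : choiceType) (M : T -> R).
Hypothesis hM : is_prob_weights M.

Definition avg (f : T -> R) : R := fine (\esum_(l in [set: T]) (M l * f l)%:E).

Let M0 l : 0 <= M l. Proof. by case: hM. Qed.

Lemma avgE f (c : R) : (forall l, 0 <= f l <= c) ->
  \esum_(l in [set: T]) (M l * f l)%:E = (avg f)%:E.
Proof.
move=> fc; have f0 l : 0 <= f l by have /andP[] := fc l.
have c0 : T -> 0 <= c by move=> l; have /andP[/le_trans h /h] := fc l.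
rewrite /avg fineK // ge0_fin_numE; last by apply: esum_ge0 => l _; rewrite lee_fin mulr_ge0.
apply: (@le_lt_trans _ _ (\esum_(l in [set: T]) (`|c| * M l)%:E)%E).
  apply: le_esum => l _; rewrite lee_fin mulrC ler_wpM2r //.
  by have /andP[_ /le_trans] := fc l; apply; exact: ler_norm.
by rewrite esumZ //; case: hM => _ ->; rewrite mule1 ltry.
Qed.

Lemma avg_ge0 f : (forall l, 0 <= f l) -> 0 <= avg f.
Proof. by move=> f0; apply/fine_ge0/esum_ge0 => l _; rewrite lee_fin mulr_ge0. Qed.

Lemma avg_cst (c : R) : 0 <= c -> avg (fun=> c) = c.
Proof.
move=> c0; rewrite /avg; under eq_esum do rewrite mulrC.
by rewrite esumZ //; case: hM => _ ->; rewrite mule1.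
Qed.

Lemma avgD f g (c d : R) : (forall l, 0 <= f l <= c) -> (forall l, 0 <= g l <= d) ->
  avg (fun l => f l + g l) = avg f + avg g.
Proof.
move=> fc gd; have f0 l : 0 <= f l by have /andP[] := fc l.
have g0 l : 0 <= g l by have /andP[] := gd l.
apply: EFin_inj; rewrite EFinD -(avgE fc) -(avgE gd) -esumD; last 2 first.
- by move=> l _; rewrite lee_fin mulr_ge0.
- by move=> l _; rewrite lee_fin mulr_ge0.
rewrite -(@avgE _ (c + d)).
  by apply: eq_esum => l _; rewrite mulrDr EFinD.
by move=> l; have /andP[? ?] := fc l; have /andP[? ?] := gd l; rewrite addr_ge0 ?lerD.
Qed.

Lemma avgZ f (a c : R) : 0 <= a -> (forall l, 0 <= f l <= c) ->
  avg (fun l => a * f l) = a * avg f.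
Proof.
move=> a0 fc; have f0 l : 0 <= f l by have /andP[] := fc l.
apply: EFin_inj; rewrite EFinM -(avgE fc) -esumZ //; last by move=> l; rewrite mulr_ge0.
rewrite -(@avgE _ (a * c)); first by apply: eq_esum => l _; rewrite mulrCA.
by move=> l; have /andP[? ?] := fc l; rewrite mulr_ge0 //= ler_wpM2l.
Qed.

Lemma avg_le f g (c d : R) : (forall l, 0 <= f l <= c) -> (forall l, 0 <= g l <= d) ->
  (forall l, f l <= g l) -> avg f <= avg g.
Proof.
move=> fc gd fg; rewrite -lee_fin -(avgE fc) -(avgE gd).
by apply: le_esum => l _; rewrite lee_fin ler_wpM2l.
Qed.

Lemma avg_leD f g h (a : R) : 0 <= a ->
  (forall l, 0 <= f l <= 1) -> (forall l, 0 <= g l <= 1) -> (forall l, 0 <= h l <= 1) ->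
  (forall l, f l <= a + g l + h l) -> avg f <= a + avg g + avg h.
Proof.
move=> a0 f1 g1 h1 H.
have aa : T -> 0 <= a <= a by rewrite a0 lexx.
have ag l : 0 <= a + g l <= a + 1 by have /andP[? ?] := g1 l; rewrite addr_ge0 //= lerD.
rewrite -[X in _ <= X + _ + _](avg_cst a0) -(avgD aa g1) -(avgD ag h1).
apply: (avg_le f1 _ H) => l; have /andP[? ?] := ag l; have /andP[? ?] := h1 l.
by apply/andP; split; [rewrite addr_ge0|apply: lerD; eassumption].
Qed.

Lemma avg_compl (P : pred T) :
  avg (fun l => (~~ P l)%:R) = 1 - avg (fun l => (P l)%:R).
Proof.
have b01 (b : bool) : 0 <= (b%:R : R) <= 1 by case: b; rewrite /= ?lexx ?ler01.
apply/eqP; rewrite eq_sym subr_eq; apply/eqP; rewrite -(@avgD _ _ 1 1) //.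
rewrite -[LHS](avg_cst ler01); congr avg; apply/funext => l.
by case: (P l); rewrite ?addr0 ?add0r.
Qed.

Lemma avg_sum (I : eqType) (r : seq I) (F : I -> T -> R) (c : I -> R) :
  (forall i l, 0 <= F i l <= c i) ->
  avg (fun l => \sum_(i <- r) F i l) = \sum_(i <- r) avg (F i).
Proof.
move=> Fc; elim: r => [|i r IH].
  by rewrite big_nil -[RHS]avg_cst //; congr avg; apply/funext => l; rewrite big_nil.
rewrite big_cons -IH -(@avgD _ _ (c i) (\sum_(i <- r) c i)) //.
  by congr avg; apply/funext => l; rewrite big_cons.
move=> l; apply/andP; split; first by apply: sumr_ge0 => k _; have /andP[] := Fc k l.
by apply: ler_sum => k _; have /andP[] := Fc k l.
Qed.

Lemma sum_le_avg (r : seq T) f (c : R) : uniq r -> (forall l, 0 <= f l <= c) ->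
  \sum_(l <- r) M l * f l <= avg f.
Proof.
move=> ur fc; rewrite -lee_fin -(avgE fc); apply: seq_le_esum => // l.
by rewrite mulr_ge0 //; have /andP[] := fc l.
Qed.

Lemma avg_point (l0 : T) : avg (fun l => (l == l0)%:R) = M l0.
Proof.
have b01 l : 0 <= ((l == l0)%:R : R) <= 1 by case: (_ == _); rewrite /= ?lexx ?ler01.
apply/eqP; rewrite eq_le; apply/andP; split; last first.
  have := @sum_le_avg [:: l0] _ _ isT b01.
  by rewrite big_cons big_nil eqxx mulr1 addr0.
rewrite -lee_fin -(avgE b01); apply: esum_le_seq => r ur.
have [lr|lr] := boolP (l0 \in r).
  rewrite (bigD1_seq l0) //= eqxx mulr1 big1 ?addr0 // => l /negPf ->.
  by rewrite mulr0.
rewrite big_seq big1 // => l l_r; case: eqP => [ll|]; last by rewrite mulr0.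
by move: lr; rewrite -ll l_r.
Qed.

End Average.

(** * Coherent systems *)

Lemma ind01 (R : realDomainType) (b : bool) : 0 <= (b%:R : R) <= 1.
Proof. by case: b; rewrite /= ?lexx ?ler01. Qed.

Section CoherentSystems.
Variables (R : realType) (q : R) (sigma : nat -> int).
Hypothesis hq : 0 < q < 1.
Hypothesis hsigma : forall N : nat, (0 < N)%N -> sigma N = 1 \/ sigma N = -1.
Hypothesis hplus : forall m : nat, exists2 N : nat, (m <= N)%N & sigma N = 1.
Hypothesis hminus : forall m : nat, exists2 N : nat, (m <= N)%N & sigma N = -1.

Notation cond_mean K f l := (cond_mean q sigma K f l).
Notation window := (window sigma).
Notation leave_bound := (leave_bound q sigma).
Notation oscillation_le := (oscillation_le q sigma).

Let condM K n (l : signature n.+1) : is_mean (fun f => cond_mean K f l) := cond_mean_mean hq hsigma K l.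

Lemma link_ge0 n (l : signature n.+2) (m : signature n.+1) : 0 <= link q sigma l m.
Proof.
rewrite (link_step_prob (base_gt0 sigma hq n) (base_neq1 hq hsigma n)).
by apply: sumr_ge0 => s _; apply: (step_prob_ge0 sigma hq).
Qed.

Lemma link_finite_support n (l : signature n.+2) :
  finite_set [set m | link q sigma l m != 0].
Proof.
apply: (sub_finite_set _ (finite_seq [seq lower s | s <- index_enum {ffun 'I_n.+1 -> 'I_(gap_bound l)}])).
rewrite (link_step_prob (base_gt0 sigma hq n) (base_neq1 hq hsigma n)) => m /=.
apply: contraNP => mr; apply/eqP/big_pred0 => s.
apply/negbTE; apply: contra_notN mr => /andP[_ /eqP <-].
by apply/map_f; rewrite mem_index_enum.
Qed.

Section OneSystem.
Variable M : system R.
Arguments M : clear implicits.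
Hypothesis hM : coherent q sigma M.

Let MP k : is_prob_weights (M k). Proof. by case: hM. Qed.
Let M0 k l : 0 <= M k l. Proof. by case: (MP k). Qed.

Lemma avg_step n (g : signature n.+1 -> R) : (forall m, 0 <= g m <= 1) ->
  avg (M n.+1) (step q sigma g) = avg (M n) g.
Proof.
move=> g01; have g0 m : 0 <= g m by have /andP[] := g01 m.
have sg01 (l : signature n.+2) : 0 <= step q sigma g l <= 1.
  have sM := step_mean hq hsigma l; apply/andP; split.
    exact: (mean_ge0 sM).
  by apply: (mean_le1 sM) => m; have /andP[] := g01 m.
apply: EFin_inj; rewrite -(avgE (MP _) sg01) -(avgE (MP _) g01).
transitivity (\esum_(l in [set: signature n.+2]) \esum_(m in [set: signature n.+1])
    (M n.+1 l * (link q sigma l m * g m))%:E)%E.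
  apply: eq_esum => l _; rewrite esumZ //; last by move=> m; rewrite mulr_ge0 ?link_ge0.
  rewrite esum_finite_support ?(step_link hq hsigma) //.
    by move=> m; rewrite mulr_ge0 ?link_ge0.
  apply: sub_finite_set (link_finite_support l) => m /=.
  by apply: contra_neq => ->; rewrite mul0r.
rewrite esum_exchange; last by move=> l m; rewrite lee_fin !mulr_ge0 ?link_ge0.
apply: eq_esum => m _; have [_ /(_ n m) cM] := hM.
under eq_esum => l _ do rewrite mulrA mulrC.
by rewrite esumZ ?cM ?EFinM 1?muleC // => l; rewrite mulr_ge0 ?link_ge0.
Qed.

Lemma avg_cond_mean k n (f : state -> R) : (k <= n)%N -> (forall x, 0 <= f x <= 1) ->
  avg (M n) (fun l => cond_mean k f l) = avg (M k) (fun l => f (st l)).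
Proof.
move=> + f01; elim: n => [|n IH].
  by rewrite leqn0 => /eqP ->.
rewrite leq_eqVlt => /orP[/eqP <-|kn]; first by congr avg; apply/funext => l; rewrite cond_mean_id.
rewrite -IH // -(@avg_step n) => [|m]; last exact: cond_mean01.
by congr avg; apply/funext => l; rewrite cond_mean_step.
Qed.

Lemma avg_window_indicator k (m : signature k.+1) :
  avg (M k) (fun l => (window k (st l) == window k (st m))%:R) = M k m.
Proof.
rewrite -[RHS](avg_point (MP k)); congr avg; apply/funext => l; congr (nat_of_bool _)%:R.
by apply/eqP/eqP => [/(@window_inj sigma)|->].
Qed.

(** The integrand at level K, extended to level n, differs from the integrand at
    level n by at most the probability that the walk leaves [window j].  Hence
    these averages form a Cauchy sequence. *)
Lemma avg_tail_event j k K n (E : pred {ffun 'I_j.+1 -> int}) (f : state -> R) :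
  (j <= K)%N -> (k <= K)%N -> (K <= n)%N -> (forall x, 0 <= f x <= 1) ->
  `|avg (M n) (fun l => (E (window j (st l)))%:R * cond_mean k f l) -
    avg (M K) (fun l => (E (window j (st l)))%:R * cond_mean k f l)| <= leave_bound j K.
Proof.
move=> jK kK Kn f01.
pose F (x : state) := cond_mean k f (tagged x).
pose G (x : state) : R := (E (window j x))%:R * F x.
have F01 x : 0 <= F x <= 1 by exact: cond_mean01.
have G01 x : 0 <= G x <= 1.
  have /andP[F0 F1] := F01 x; rewrite /G; case: (E _); rewrite ?mul1r ?mul0r //=.
  by rewrite lexx ler01.
have lb0 : 0 <= leave_bound j K.
  by rewrite subr_ge0 -[leRHS]expR0 ler_expR oppr_le0 drift_ge0.
have -> : avg (M K) (fun l => (E (window j (st l)))%:R * cond_mean k f l) =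
    avg (M n) (fun l => cond_mean K G l) by rewrite avg_cond_mean.
have eG01 (l : signature n.+1) : 0 <= cond_mean K G l <= 1 by exact: cond_mean01.
have fl01 (l : signature n.+1) : 0 <= (E (window j (st l)))%:R * cond_mean k f l <= 1 by exact: (G01 (st l)).
have z01 (l : signature n.+1) : 0 <= (0 : R) <= 1 by rewrite lexx ler01.
have close (l : signature n.+1) :
   cond_mean K G l <= leave_bound j K + (E (window j (st l)))%:R * cond_mean k f l /\
   (E (window j (st l)))%:R * cond_mean k f l <= leave_bound j K + cond_mean K G l.
  have Fl : cond_mean k f l = cond_mean K F l by exact: cond_mean_tower.
  have lv := cond_mean_leave hq hsigma l jK Kn.
  rewrite Fl; case El: (E (window j (st l))).
  - rewrite mul1r; split.
      apply: le_trans (_ : cond_mean K F l <= _); last by rewrite lerDr.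
      apply: (mean_le (condM K l)) => x; rewrite /G; have /andP[F0 _] := F01 x.
      by case: (E _); rewrite ?mul1r ?mul0r.
    apply: (@le_trans _ _ (0 + 1 * cond_mean K (fun x => (window j x != window j (st l))%:R) l + cond_mean K G l)).
      apply: (mean_leD (condM K l)) => x; rewrite /G add0r mul1r; have /andP[F0 F1] := F01 x.
      case: eqP => [->|_]; first by rewrite El mul1r add0r.
      by apply: (le_trans F1); rewrite lerDl mulr_ge0.
    by rewrite add0r mul1r lerD2r.
  - rewrite mul0r addr0; split; last by have /andP[h _] := eG01 l; rewrite addr_ge0.
    apply: le_trans lv; apply: (mean_le (condM K l)) => x; rewrite /G; have /andP[F0 F1] := F01 x.
    by case: eqP => [->|_]; rewrite ?El ?mul0r //=; case: (E _); rewrite ?mul1r ?mul0r.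
rewrite ler_distl; apply/andP; split.
  rewrite lerBlDl; have := avg_leD (MP n) lb0 eG01 fl01 z01.
  rewrite (avg_cst (MP n)) // addr0; apply=> l; rewrite addr0; by case: (close l).
rewrite addrC; have := avg_leD (MP n) lb0 fl01 eG01 z01.
by rewrite (avg_cst (MP n)) // addr0; apply=> l; rewrite addr0; case: (close l).
Qed.

End OneSystem.
End CoherentSystems.

Lemma avg_dominated (R : realType) (T : choiceType) (M M1 : T -> R) (C : R) (g : T -> R) :
  is_prob_weights M -> is_prob_weights M1 -> 0 <= C -> (forall l, M1 l <= C * M l) ->
  (forall l, 0 <= g l <= 1) -> avg M1 g <= C * avg M g.
Proof.
move=> MP M1P C0 le_M g01; have g0 l : 0 <= g l by have /andP[] := g01 l.
have M0 l : 0 <= M l by case: MP.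
rewrite -lee_fin EFinM -(avgE MP g01) -(avgE M1P g01) -esumZ //; last by move=> l; rewrite mulr_ge0.
by apply: le_esum => l _; rewrite lee_fin mulrA ler_wpM2r.
Qed.

(** * Concentrated systems *)

Section Concentration.
Variables (R : realType) (q : R) (sigma : nat -> int).
Hypothesis hq : 0 < q < 1.
Hypothesis hsigma : forall N : nat, (0 < N)%N -> sigma N = 1 \/ sigma N = -1.
Hypothesis hplus : forall m : nat, exists2 N : nat, (m <= N)%N & sigma N = 1.
Hypothesis hminus : forall m : nat, exists2 N : nat, (m <= N)%N & sigma N = -1.

Notation cond_mean K f l := (cond_mean q sigma K f l).
Notation window := (window sigma).
Notation leave_bound := (leave_bound q sigma).
Notation oscillation_le := (oscillation_le q sigma).
Notation at_level k m := (fun x : state => (window k x == window k (st m))%:R).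

Let condM K n (l : signature n.+1) : is_mean (fun f => cond_mean K f l) := cond_mean_mean hq hsigma K l.

(** The law of every window converges to a point mass. *)
Definition concentrated (M : system R) : Prop :=
  forall (j : nat) (e : R), 0 < e -> exists K (v : {ffun 'I_j.+1 -> int}),
    (j <= K)%N /\ forall n, (K <= n)%N ->
      avg (@M n) (fun l => (window j (st l) != v)%:R) <= e.

Lemma at_level_eq k (m m' : signature k.+1) :
  (window k (st m) == window k (st m')) = (m == m').
Proof. by apply/eqP/eqP => [/(@window_inj sigma)|->]. Qed.

Lemma sum_at_level_le1 k (r : seq (signature k.+1)) (P : pred (signature k.+1)) (m : signature k.+1) :
  uniq r -> \sum_(m' <- r | P m') ((at_level k m') (st m) : R) <= (P m)%:R.
Proof.
move=> ur; under eq_bigr do rewrite at_level_eq.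
have [Pm|Pm] := boolP (P m); last first.
  by rewrite big1 // => m' Pm'; case: eqP => // mm'; move: Pm; rewrite mm' Pm'.
apply: (@le_trans _ _ (\sum_(m' <- r) (m == m')%:R)).
  by rewrite big_mkcond; apply: ler_sum => m' _; case: ifP.
have [mr|mr] := boolP (m \in r).
  rewrite (bigD1_seq m) //= eqxx big1 ?addr0 // => m' m'm.
  by rewrite eq_sym (negPf m'm).
rewrite big_seq big1 // => m' m'r; case: eqP => // mm'.
by move: mr; rewrite mm' m'r.
Qed.

Lemma event_nonempty (T : choiceType) (Mn : T -> R) (P : pred T) :
  is_prob_weights Mn -> avg Mn (fun l => (~~ P l)%:R) < 1 -> exists l, P l.
Proof.
move=> MP lt1; apply: contrapT => none; move: lt1.
rewrite (_ : (fun l => _) = (fun=> 1)); first by rewrite (avg_cst MP) ?ltxx.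
by apply/funext => l; case: (boolP (P l)) => // Pl; exfalso; apply: none; exists l.
Qed.

(** When almost all mass at level n shows the window of l0, the weights at level k
    are nearly those of the walk from l0. *)
Lemma window_approx (M : system R) k (m : signature k.+1) j n (l0 : signature n.+1) (e eta : R) :
  coherent q sigma M -> (k <= n)%N -> (j <= n)%N -> 0 <= e ->
  oscillation_le k (at_level k m) j e ->
  avg (@M n) (fun l => (window j (st l) != window j (st l0))%:R) <= eta ->
  `|M k m - cond_mean k (at_level k m) l0| <= e + eta.
Proof.
move=> hM kn jn e0 osc bad; have MP : is_prob_weights (@M n) by case: hM.
have f01 (x : state) : 0 <= ((at_level k m) x : R) <= 1 by exact: ind01.
rewrite -(avg_window_indicator hM) -(avg_cond_mean hq hsigma hM kn f01).
have G01 n' (l : signature n'.+1) := cond_mean01 hq hsigma k f01 l.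
have /andP[g0 g1] := G01 n l0.
have b01 (l : signature n.+1) : 0 <= ((window j (st l) != window j (st l0))%:R : R) <= 1 by exact: ind01.
rewrite ler_distl; apply/andP; split.
  rewrite lerBlDl -(avg_cst MP g0); apply: (@le_trans _ _ (e +
      avg (@M n) (fun l => cond_mean k (at_level k m) l) +
      avg (@M n) (fun l => (window j (st l) != window j (st l0))%:R))); last first.
    by rewrite addrAC lerD2r lerD2l.
  apply: (avg_leD MP e0 _ (G01 n) b01) => l; first by rewrite g0 g1.
  have [w|w] := eqVneq (window j (st l)) (window j (st l0)).
    by rewrite addr0 -lerBlDr; apply: osc.
  have /andP[h0 h1] := G01 _ l.
  by apply: (le_trans g1); rewrite lerDr addr_ge0.
apply: (@le_trans _ _ (e + cond_mean k (at_level k m) l0 +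
      avg (@M n) (fun l => (window j (st l) != window j (st l0))%:R))); last first.
  by rewrite [e + _]addrC -addrA !lerD2l.
rewrite -(avg_cst MP g0); apply: (avg_leD MP e0 (G01 n) _ b01) => l; first by rewrite g0 g1.
have [w|w] := eqVneq (window j (st l)) (window j (st l0)).
  by rewrite addr0 -lerBlDr; apply: osc.
have /andP[h0 h1] := G01 _ l.
by apply: (le_trans h1); rewrite lerDr addr_ge0.
Qed.

Lemma eq_of_close (x y : R) : (forall e, 0 < e -> `|x - y| <= e) -> x = y.
Proof.
move=> H; apply/eqP; rewrite -subr_eq0 -normr_le0 leNgt; apply/negP => h.
have := H (`|x - y| / 2); rewrite divr_gt0 // => /(_ isT).
by move: h; move: `|x - y| => z; lra.
Qed.

(** Domination forces M1 to be concentrated at the same windows as M, and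
    [window_approx] then compares both systems with one and the same walk. *)
Lemma concentrated_dominates (M M1 : system R) (C : R) :
  coherent q sigma M -> coherent q sigma M1 -> 0 <= C ->
  (forall k (l : signature k.+1), M1 k l <= C * M k l) ->
  concentrated M -> M1 = M.
Proof.
move=> hM hM1 C0 le_M conc; apply: functional_extensionality_dep => k; apply/funext => m.
apply: eq_of_close => e e0.
have f01 (x : state) : 0 <= ((at_level k m) x : R) <= 1 by exact: ind01.
have e40 : 0 < e / 4 by rewrite divr_gt0.
have [j kj osc] := oscillation_small hq hsigma hplus hminus k f01 e40.
(* The bound 1/2 makes the good event nonempty; the other one absorbs C. *)
pose eta := Num.min (1 / 2) (e / 4 / (C + 1)).
have C1 : 0 < C + 1 by rewrite ltr_wpDl.
have eta0 : 0 < eta by rewrite lt_min !divr_gt0.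
have [K [v [jK bad]]] := conc j eta eta0.
have MP : is_prob_weights (@M K) by case: hM.
have M1P : is_prob_weights (@M1 K) by case: hM1.
have {}bad := bad K (leqnn K).
have [l0 /eqP l0v] : exists l : signature K.+1, window j (st l) == v.
  apply: (event_nonempty (P := fun l => window j (st l) == v) MP).
  apply: (le_lt_trans bad); rewrite gt_min; apply/orP; left; lra.
have eta_e : eta <= e / 4.
  rewrite ge_min; apply/orP; right; rewrite ler_pdivrMr // ler_peMr ?(ltW e40) //.
  by rewrite lerDr.
have Ceta_e : C * eta <= e / 4.
  apply: (@le_trans _ _ (C * (e / 4 / (C + 1)))).
    by rewrite ler_wpM2l // ge_min lexx orbT.
  by rewrite mulrCA ler_piMr ?(ltW e40) // ler_pdivrMr // mul1r lerDl.
have b01 (l : signature K.+1) : 0 <= ((window j (st l) != v)%:R : R) <= 1 by exact: ind01.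
have bad1 : avg (@M1 K) (fun l => (window j (st l) != v)%:R) <= e / 4.
  apply: le_trans Ceta_e; apply: le_trans (avg_dominated MP M1P C0 (le_M K) b01) _.
  exact: ler_wpM2l.
rewrite -l0v in bad bad1.
have kK := leq_trans kj jK.
have h := window_approx hM kK jK (ltW e40) osc (le_trans bad eta_e).
have h1 := window_approx hM1 kK jK (ltW e40) osc bad1.
apply: le_trans (ler_distD (cond_mean k (at_level k m) l0) _ _) _.
rewrite [X in _ + X]distrC; move: h h1.
by move: `|_ - _| `|_ - _| => a b; lra.
Qed.

Lemma avg_window_stable (M : system R) j K n (P : pred {ffun 'I_j.+1 -> int}) :
  coherent q sigma M -> (j <= K)%N -> (K <= n)%N ->
  `|avg (@M n) (fun l => (P (window j (st l)))%:R) - avg (@M K) (fun l => (P (window j (st l)))%:R)|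
    <= leave_bound j K.
Proof.
move=> hM jK Kn.
have one01 (x : state) : 0 <= (1 : R) <= 1 by rewrite ler01 lexx.
have := avg_tail_event hq hsigma hM P jK (leq0n K) Kn one01.
have E n' : (fun l : signature n'.+1 => (P (window j (st l)))%:R * cond_mean 0 (fun=> 1) l) =
    (fun l : signature n'.+1 => (P (window j (st l)))%:R).
  by apply/funext => l; rewrite (mean_cst (condM 0 l)) mulr1.
by rewrite !E.
Qed.

(** For large d the law at level K of the walk from lambda(d + K) is close to M on
    a finite set of nearly full mass, and it nearly keeps the window of
    lambda(d + K); so M at level K gives nearly full mass to that window. *)
Lemma Martin_concentrated (M : system R) : Martin_boundary q sigma M -> concentrated M.
Proof.
move=> [hM [lam conv]] j e e0.
have e40 : 0 < e / 4 by rewrite divr_gt0.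
have [K jK lbK] := leave_bound_small hq hplus hminus j e40.
have MP : is_prob_weights (@M K) by case: hM.
have [r ur mass_r] : exists2 r : seq (signature K.+1), uniq r &
    1 - e / 4 <= \sum_(l <- r) M K l.
  by apply: esum_seq_approx => //; case: MP.
have near_all (s : seq (signature K.+1)) (e' : R) : 0 < e' ->
    exists d, forall m, m \in s -> forall d', (d <= d')%N ->
    M K m <= links q sigma (lam (d' + K)%N) m + e'.
  move=> e'0; elim: s => [|m s [d0 IH]]; first by exists 0%N.
  have /cvgrPdist_le/(_ _ e'0)[d1 _ hd1] := conv K m.
  exists (maxn d0 d1) => m'; rewrite inE => /orP[/eqP -> d'|/IH h d'].
    by rewrite geq_max => /andP[_ /hd1] /=; rewrite ler_distl => /andP[_ h].
  by rewrite geq_max => /andP[/h].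
(* The error is shared among the elements of r, so that its sum stays below e / 4. *)
have [|d /(_ _ _ d (leqnn d)) hd] := near_all r (e / 4 / (size r).+1%:R).
  by rewrite divr_gt0.
set l0 := lam (d + K)%N in hd; exists K, (window j (st l0)); split => // n Kn.
pose out (m : signature K.+1) := window j (st m) != window j (st l0).
have Kd : (K <= d + K)%N by rewrite leq_addl.
have out_links : \sum_(m <- r | out m) links q sigma l0 m <= e / 4.
  apply: le_trans (lbK K (leqnn K)).
  apply: le_trans (cond_mean_leave hq hsigma l0 jK Kd).
  under eq_bigr => m _ do rewrite (links_cond_mean hq hsigma).
  rewrite -(mean_sum _ _ _ (condM K l0)); apply: (cond_mean_le hq hsigma) => // m.
  exact: sum_at_level_le1.
have out_M : \sum_(m <- r | out m) M K m <= e / 2.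
  apply: (@le_trans _ _ (\sum_(m <- r | out m) links q sigma l0 m +
      \sum_(m <- r) e / 4 / (size r).+1%:R)).
    rewrite [X in _ + X](bigID out) /= addrA -big_split /= -[leLHS]addr0 lerD //.
      rewrite big_seq_cond [leRHS]big_seq_cond; apply: ler_sum => m /andP[mr _].
      exact: hd.
    by apply: sumr_ge0 => m _; rewrite divr_ge0 // ltW.
  have -> : e / 2 = e / 4 + e / 4 by lra.
  rewrite lerD // big_const_seq count_predT iter_addr_0 -[_ *+ size r]mulr_natr.
  by rewrite -mulrA ler_piMr ?(ltW e40) // mulrC ler_pdivrMr // mul1r ler_nat.
have in_M : 1 - 3 * e / 4 <= avg (@M K) (fun l => (window j (st l) == window j (st l0))%:R).
  have b01 (l : signature K.+1) : 0 <= ((window j (st l) == window j (st l0))%:R : R) <= 1 by exact: ind01.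
  apply: le_trans (sum_le_avg MP ur b01).
  rewrite (eq_bigr (fun m => if ~~ out m then M K m else 0)); last first.
    by move=> m _; rewrite /out negbK; case: eqP; rewrite ?mulr1 ?mulr0.
  rewrite -big_mkcond /=; move: mass_r; rewrite (bigID out) /=.
  by move: out_M; move: (\sum_(_ <- _ | _) _) (\sum_(_ <- _ | _) _) => a b *; lra.
have := avg_window_stable (fun w => w != window j (st l0)) hM jK Kn.
rewrite ler_distl => /andP[_ h]; apply: (le_trans h).
rewrite (avg_compl MP (fun l => window j (st l) == window j (st l0))).
have := lbK K (leqnn K); move: in_M.
by move: (avg _ _) (leave_bound j K) => a b *; lra.
Qed.

End Concentration.

(** * Splitting a coherent system along a limiting window *)

Lemma cvgn_sum (R : realType) (I : Type) (r : seq I) (u : I -> nat -> R) (a : I -> R) :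
  (forall i, u i n @[n --> \oo] --> a i) ->
  (\sum_(i <- r) u i n) @[n --> \oo] --> \sum_(i <- r) a i.
Proof.
move=> ua; elim: r => [|i r IH].
  by under eq_fun do rewrite big_nil; rewrite big_nil; exact: cvg_cst.
by under eq_fun do rewrite big_cons; rewrite big_cons; exact: cvgD.
Qed.

Lemma cvgn_of_cauchy (R : realType) (u : nat -> R) :
  (forall e, 0 < e -> exists K, forall n, (K <= n)%N -> `|u n - u K| <= e) ->
  cvg (u n @[n --> \oo]).
Proof.
move=> H; apply/cauchy_cvgP/cauchy_exP => e e0.
have e20 : 0 < e / 2 by rewrite divr_gt0.
have [K hK] := H _ e20.
exists (u K), K => // n /= Kn; rewrite /ball /= distrC.
by apply: le_lt_trans (hK n Kn) _; move: e0; clear; lra.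
Qed.

Lemma ereal_split_eq (R : realType) (x y : \bar R) (a b : R) :
  (x <= a%:E -> y <= b%:E -> x + y = (a + b)%:E -> x = a%:E)%E.
Proof.
case: x y => [x| |] [y| |] //=; rewrite !lee_fin => xa yb [] xy.
congr (_%:E); lra.
Qed.

Lemma fsum_point (R : pzSemiRingType) (T : choiceType) (f : T -> R) (x : T) :
  \sum_(y \in [set: T]) f y * (y == x)%:R = f x.
Proof.
rewrite (@fsum_seq _ _ [:: x]) // => [|y].
  by rewrite big_cons big_nil eqxx mulr1 addr0.
by rewrite inE => /negPf ->; rewrite mulr0.
Qed.

Section TailParts.
Variables (R : realType) (q : R) (sigma : nat -> int).
Hypothesis hq : 0 < q < 1.
Hypothesis hsigma : forall N : nat, (0 < N)%N -> sigma N = 1 \/ sigma N = -1.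
Hypothesis hplus : forall m : nat, exists2 N : nat, (m <= N)%N & sigma N = 1.
Hypothesis hminus : forall m : nat, exists2 N : nat, (m <= N)%N & sigma N = -1.

Notation cond_mean K f l := (cond_mean q sigma K f l).
Notation window := (window sigma).
Notation leave_bound := (leave_bound q sigma).
Notation at_level k m := (fun x : state => (window k x == window k (st m))%:R).

Let condM K n (l : signature n.+1) : is_mean (fun f => cond_mean K f l) := cond_mean_mean hq hsigma K l.

Variables (M : system R) (j : nat).
Arguments M : clear implicits.
Hypothesis hM : coherent q sigma M.
Let MP k : is_prob_weights (M k). Proof. by case: hM. Qed.

Implicit Type E : pred {ffun 'I_j.+1 -> int}.

Definition tail E k (f : state -> R) (n : nat) : R :=
  avg (M n) (fun l => (E (window j (st l)))%:R * cond_mean k f l).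

Definition tail_lim E k (f : state -> R) : R := lim (tail E k f n @[n --> \oo]).

(** The restriction of the system to the event that the limiting value of
    [window j] satisfies E. *)
Definition tail_part E : system R := fun k m => tail_lim E k (at_level k m).

Definition tail_mass E : R := tail_lim E 0 (fun=> 1).

Let at01 k (m : signature k.+1) (x : state) : 0 <= ((at_level k m) x : R) <= 1.
Proof. exact: ind01. Qed.

Let one01 (x : state) : 0 <= (1 : R) <= 1. Proof. by rewrite ler01 lexx. Qed.

Lemma event_cond_mean01 E k f n (l : signature n.+1) : (forall x, 0 <= f x <= 1) ->
  0 <= (E (window j (st l)))%:R * cond_mean k f l <= 1.
Proof.
move=> f01; have /andP[h0 h1] := cond_mean01 hq hsigma k f01 l.
by case: (E _); rewrite ?mul1r ?mul0r ?h0 ?h1 // lexx ler01.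
Qed.

Lemma tail_cvg E k f : (forall x, 0 <= f x <= 1) ->
  tail E k f n @[n --> \oo] --> tail_lim E k f.
Proof.
move=> f01; apply: cvgn_of_cauchy => e e0.
have [K jK lbK] := leave_bound_small hq hplus hminus j e0.
exists (maxn K k) => n; rewrite geq_max => /andP[Kn kn].
apply: le_trans (lbK (maxn K k) (leq_maxl _ _)).
apply: avg_tail_event => //; rewrite ?leq_maxr ?geq_max ?Kn //.
by rewrite (leq_trans jK) ?leq_maxl.
Qed.

Lemma tail_one E n : tail E 0 (fun=> 1) n = avg (M n) (fun l => (E (window j (st l)))%:R).
Proof.
by congr avg; apply/funext => l; rewrite (mean_cst (condM 0 l)) mulr1.
Qed.

Lemma event_cvg E : avg (M n) (fun l => (E (window j (st l)))%:R) @[n --> \oo] --> tail_mass E.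
Proof.
rewrite -(_ : tail E 0 (fun=> 1) = fun n => avg (M n) (fun l => (E (window j (st l)))%:R)).
  exact: tail_cvg.
by apply/funext => n; rewrite tail_one.
Qed.

Lemma tail_part_cvg E k (m : signature k.+1) :
  tail E k (at_level k m) n @[n --> \oo] --> tail_part E m.
Proof. exact: tail_cvg. Qed.

Lemma tail_part_ge0 E k m : 0 <= tail_part E (k := k) m.
Proof.
have h := @tail_part_cvg E k m.
apply: (cvgr_to_ge h).
apply: nearW => n; apply: (avg_ge0 (MP n)) => l.
by have /andP[] := event_cond_mean01 E k l (at01 m).
Qed.

Lemma tail_part_sum_le E k (r : seq (signature k.+1)) (c : signature k.+1 -> R)
    (u : nat -> R) (b : R) :
  (forall m, 0 <= c m) -> u n @[n --> \oo] --> b ->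
  (exists n0, forall n, (n0 <= n)%N ->
     avg (M n) (fun l => (E (window j (st l)))%:R * \sum_(m <- r) c m * cond_mean k (at_level k m) l)
       <= u n) ->
  \sum_(m <- r) c m * tail_part E m <= b.
Proof.
move=> c0 ub [n0 hn0].
apply: (ler_cvg_to (f := fun n => \sum_(m <- r) c m * tail E k (at_level k m) n) _ ub).
  apply: cvgn_sum => m; apply: cvgM; [exact: cvg_cst|exact: tail_cvg].
exists n0 => // n /= /hn0; apply: le_trans; rewrite le_eqVlt; apply/orP; left; apply/eqP.
under eq_bigr => m _ do rewrite /tail -(avgZ (MP n) (c0 m) (fun l => event_cond_mean01 E k l (at01 m))).
rewrite -(@avg_sum _ _ _ (MP n) _ _ _ c).
  congr avg; apply/funext => l; rewrite mulr_sumr; apply: eq_bigr => m _.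
  by rewrite mulrCA.
move=> m l; have /andP[h0 h1] := event_cond_mean01 E k l (at01 m).
by rewrite mulr_ge0 //= ler_piMr.
Qed.

Lemma esum_tail_part_le E k :
  (\esum_(m in [set: signature k.+1]) (tail_part E m)%:E <= (tail_mass E)%:E)%E.
Proof.
apply: esum_le_seq => r ur.
under eq_bigr do rewrite -[tail_part _ _]mul1r.
apply: (@tail_part_sum_le E k r (fun=> 1) _ _ (fun=> ler01) (@event_cvg E)).
exists k => n kn.
have b01 (l : signature n.+1) : 0 <= ((E (window j (st l)))%:R : R) <= 1 by exact: ind01.
have le1 (l : signature n.+1) : \sum_(m <- r) 1 * cond_mean k (at_level k m) l <= 1.
  under eq_bigr do rewrite mul1r.
  rewrite -(mean_sum _ _ _ (condM k l)).
  rewrite -[leRHS](mean_cst (condM k l)); apply: (cond_mean_le hq hsigma) => // m.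
  exact: (@sum_at_level_le1 R sigma k r xpredT m ur).
have ge0 (l : signature n.+1) : 0 <= \sum_(m <- r) 1 * cond_mean k (at_level k m) l.
  by apply: sumr_ge0 => m _; rewrite mul1r; have /andP[] := cond_mean01 hq hsigma k (at01 m) l.
apply: (avg_le (MP n) (c := 1) _ b01) => l.
  by have /andP[? ?] := b01 l; rewrite mulr_ge0 //= mulr_ile1.
by have /andP[? ?] := b01 l; rewrite ler_piMr.
Qed.

Lemma esum_tail_part_link_le E k (m : signature k.+1) :
  (\esum_(l in [set: signature k.+2]) (tail_part E l * link q sigma l m)%:E <=
   (tail_part E m)%:E)%E.
Proof.
apply: esum_le_seq => r ur; under eq_bigr do rewrite mulrC.
apply: (@tail_part_sum_le E k.+1 r (fun l => link q sigma l m) _ _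
  (fun l => link_ge0 hq hsigma l m) (@tail_part_cvg E k m)).
exists k.+1 => n kn.
have le_cond_mean (l : signature n.+1) :
    \sum_(m' <- r) link q sigma m' m * cond_mean k.+1 (at_level k.+1 m') l <= cond_mean k (at_level k m) l.
  under eq_bigr do rewrite -(meanZ (condM k.+1 l)).
  rewrite -(mean_sum _ _ _ (condM k.+1 l)) (cond_mean_tower q sigma (at_level k m) l (leqnSn k) kn).
  apply: (cond_mean_le hq hsigma) => // x; rewrite [tagged _]/=.
  have -> : cond_mean k (at_level k m) x = link q sigma x m.
    rewrite (cond_mean_step q sigma (at_level k m) x (leqnn k)) -(step_link hq hsigma) -(fsum_point (link q sigma x) m).
    by apply: eq_fsbigr => m' _; rewrite cond_mean_id at_level_eq.
  under eq_bigr do rewrite at_level_eq.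
  have [xr|xr] := boolP (x \in r).
    rewrite (bigD1_seq x) //= eqxx mulr1 big1 ?addr0 // => m' m'x.
    by rewrite eq_sym (negPf m'x) mulr0.
  rewrite big_seq big1 ?link_ge0 // => m' m'r; case: eqP => [xm|]; last by rewrite mulr0.
  by move: xr; rewrite xm m'r.
have ge0 (l : signature n.+1) :
    0 <= \sum_(m' <- r) link q sigma m' m * cond_mean k.+1 (at_level k.+1 m') l.
  apply: sumr_ge0 => m' _; rewrite mulr_ge0 ?link_ge0 //.
  by have /andP[] := cond_mean01 hq hsigma k.+1 (at01 m') l.
have b01 (l : signature n.+1) : 0 <= ((E (window j (st l)))%:R : R) <= 1 by exact: ind01.
apply: (avg_le (MP n) (c := 1) _ (fun l => event_cond_mean01 E k l (at01 m))) => l.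
  have /andP[? ?] := b01 l; have /andP[_ h1] := cond_mean01 hq hsigma k (at01 m) l.
  by rewrite mulr_ge0 //= mulr_ile1 // (le_trans (le_cond_mean l)).
by have /andP[? ?] := b01 l; rewrite ler_wpM2l.
Qed.

Lemma tail_mass_compl E : tail_mass (predC E) = 1 - tail_mass E.
Proof.
apply: (cvg_unique _ (@event_cvg (predC E))) => //.
rewrite (_ : (fun n => _) = fun n => 1 - avg (M n) (fun l => (E (window j (st l)))%:R)).
  by apply: cvgB; [exact: cvg_cst|exact: event_cvg].
by apply/funext => n; rewrite -(avg_compl (MP n)).
Qed.

Lemma tail_part_compl E k (m : signature k.+1) :
  tail_part E m + tail_part (predC E) m = M k m.
Proof.
have h : tail E k (at_level k m) n + tail (predC E) k (at_level k m) n @[n --> \oo] -->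
    tail_part E m + tail_part (predC E) m by apply: cvgD; exact: tail_part_cvg.
apply: (cvg_unique _ h) => //; apply: cvg_near_cst.
exists k => // n /= kn.
rewrite -(@avgD _ _ _ (MP n) _ _ 1 1); last 2 first.
- by move=> l; exact: event_cond_mean01.
- by move=> l; exact: event_cond_mean01.
rewrite -(avg_window_indicator hM) -(avg_cond_mean hq hsigma hM kn (at01 m)).
congr avg; apply/funext => l; rewrite -mulrDl /=.
by case: (E _); rewrite ?addr0 ?add0r mul1r.
Qed.

(** Finite sums pass to the limit and give one inequality, for E and for its
    complement; as the two inequalities add up to an equality, both are sharp.
    The same argument gives [esum_tail_part_link]. *)
Lemma esum_tail_part E k :
  (\esum_(m in [set: signature k.+1]) (tail_part E m)%:E = (tail_mass E)%:E)%E.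
Proof.
apply: (ereal_split_eq (esum_tail_part_le E k) (esum_tail_part_le (predC E) k)).
rewrite tail_mass_compl [tail_mass E + _]addrC subrK -esumD; last 2 first.
- by move=> m _; rewrite lee_fin tail_part_ge0.
- by move=> m _; rewrite lee_fin tail_part_ge0.
have [_ <-] := MP k.
by apply: eq_esum => m _; rewrite -EFinD tail_part_compl.
Qed.

Lemma esum_tail_part_link E k (m : signature k.+1) :
  (\esum_(l in [set: signature k.+2]) (tail_part E l * link q sigma l m)%:E =
   (tail_part E m)%:E)%E.
Proof.
apply: (ereal_split_eq (esum_tail_part_link_le E m) (esum_tail_part_link_le (predC E) m)).
rewrite tail_part_compl -esumD; last 2 first.
- by move=> l _; rewrite lee_fin mulr_ge0 ?link_ge0 ?tail_part_ge0.
- by move=> l _; rewrite lee_fin mulr_ge0 ?link_ge0 ?tail_part_ge0.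
have [_ /(_ k m) <-] := hM.
by apply: eq_esum => l _; rewrite -EFinD -mulrDl tail_part_compl.
Qed.

Lemma tail_part_coherent E : 0 < tail_mass E ->
  coherent q sigma (fun k m => (tail_mass E)^-1 * tail_part E (k := k) m).
Proof.
move=> w0; have w'0 : 0 <= (tail_mass E)^-1 by rewrite invr_ge0 ltW.
split=> [k|k m]; first split=> [m|].
- by rewrite mulr_ge0 // tail_part_ge0.
- rewrite esumZ // => [|m]; last exact: tail_part_ge0.
  by rewrite esum_tail_part -EFinM mulVf // gt_eqF.
- under eq_esum do rewrite -mulrA.
  rewrite esumZ // => [|l]; last by rewrite mulr_ge0 ?link_ge0 ?tail_part_ge0.
  by rewrite esum_tail_part_link.
Qed.

(** From a signature with E, the walk reaches the complement of E only if it
    leaves [window j]. *)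
Lemma tail_part_outside E K : (j <= K)%N ->
  (\esum_(m in [set: signature K.+1])
     ((~~ E (window j (st m)))%:R * tail_part E m)%:E <= (leave_bound j K)%:E)%E.
Proof.
move=> jK; apply: esum_le_seq => r ur.
have lb0 : 0 <= leave_bound j K.
  by rewrite subr_ge0 -[leRHS]expR0 ler_expR oppr_le0 drift_ge0.
have c0 (m : signature K.+1) : 0 <= ((~~ E (window j (st m)))%:R : R) by exact: ler0n.
apply: (@tail_part_sum_le E K r _ _ _ c0 (cvg_cst (leave_bound j K))).
exists K => n Kn; rewrite -[leRHS](avg_cst (MP n)) //.
have ge0 (l : signature n.+1) : 0 <= \sum_(m <- r) (~~ E (window j (st m)))%:R * cond_mean K (at_level K m) l.
  by apply: sumr_ge0 => m _; rewrite mulr_ge0 //; have /andP[] := cond_mean01 hq hsigma K (at01 m) l.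
have small (l : signature n.+1) : (E (window j (st l)))%:R *
    (\sum_(m <- r) (~~ E (window j (st m)))%:R * cond_mean K (at_level K m) l) <= leave_bound j K.
  case El: (E _); last by rewrite mul0r.
  rewrite mul1r; apply: le_trans (cond_mean_leave hq hsigma l jK Kn).
  rewrite (eq_bigr (fun m => if ~~ E (window j (st m)) then cond_mean K (at_level K m) l else 0)); last first.
    by move=> m _; case: (E _); rewrite /= ?mul0r ?mul1r.
  rewrite -big_mkcond /= -(mean_sum _ _ _ (condM K l)).
  apply: (cond_mean_le hq hsigma) => // m.
  apply: le_trans (@sum_at_level_le1 R sigma K r (fun m' => ~~ E (window j (st m'))) m ur) _.
  by case: eqP => [->|_]; rewrite ?El // ler_nat leq_b1.
apply: (avg_le (MP n) (c := leave_bound j K) (d := leave_bound j K)) => // l.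
  by rewrite small andbT mulr_ge0.
by rewrite lb0 lexx.
Qed.

End TailParts.

(** * The two boundaries *)

Lemma rescale_part (F : fieldType) (w x : F) :
  1 - w != 0 -> x = (1 - w) * (w * ((1 - w)^-1 * x) + x).
Proof. by move=> w1; field. Qed.

Section Boundaries.
Variables (R : realType) (q : R) (sigma : nat -> int).
Hypothesis hq : 0 < q < 1.
Hypothesis hsigma : forall N : nat, (0 < N)%N -> sigma N = 1 \/ sigma N = -1.
Hypothesis hplus : forall m : nat, exists2 N : nat, (m <= N)%N & sigma N = 1.
Hypothesis hminus : forall m : nat, exists2 N : nat, (m <= N)%N & sigma N = -1.

Notation cond_mean K f l := (cond_mean q sigma K f l).
Notation window := (window sigma).
Notation at_level k m := (fun x : state => (window k x == window k (st m))%:R).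

(** A zero-one law.  If 0 < w < 1, extremality makes the part on the complement of
    E equal to (1 - w) M; by [tail_part_outside] it gives E a mass that vanishes
    in the limit, whereas (1 - w) M gives E a mass that tends to (1 - w) w. *)
Lemma minimal_tail_mass (M : system R) j (E : pred {ffun 'I_j.+1 -> int}) :
  minimal_boundary q sigma M -> 0 < tail_mass q sigma M E ->
  tail_mass q sigma M E = 1.
Proof.
move=> [hM extremal]; have MP k : is_prob_weights (@M k) by case: hM.
set w := tail_mass q sigma M E => w0; apply/eqP; rewrite eq_le; apply/andP; split.
  apply: (cvgr_to_le (@event_cvg _ _ _ hq hsigma hplus hminus M j hM E)).
  apply: nearW => n; rewrite -[leRHS](avg_cst (MP n) ler01).
  by apply: (avg_le (MP n) (c := 1) (d := 1)) => l; rewrite ?ind01 ?ler01 ?lexx //;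
    case: (E _).
rewrite leNgt; apply/negP => w1.
have wc : tail_mass q sigma M (predC E) = 1 - w by exact: tail_mass_compl.
have wc0 : 0 < 1 - w by rewrite subr_gt0.
pose M1 : system R := fun k m => w^-1 * tail_part q sigma M E (k := k) m.
pose M2 : system R := fun k m => (1 - w)^-1 * tail_part q sigma M (predC E) (k := k) m.
have M1M2 : M1 = M2.
  apply: (extremal M1 M2 w).
  - exact: tail_part_coherent.
  - by rewrite /M2 -wc; apply: tail_part_coherent => //; rewrite wc.
  - by rewrite w0 w1.
  - move=> k l; rewrite /M1 /M2 !mulVKf ?gt_eqF //; exact/esym/tail_part_compl.
have partE k (m : signature k.+1) : tail_part q sigma M (predC E) m = (1 - w) * M k m.
  have e : w^-1 * tail_part q sigma M E m = (1 - w)^-1 * tail_part q sigma M (predC E) m.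
    by have := congr1 (fun F : system R => F k m) M1M2.
  rewrite -(tail_part_compl hq hsigma hplus hminus hM E m).
  have -> : tail_part q sigma M E m = w * ((1 - w)^-1 * tail_part q sigma M (predC E) m).
    by rewrite -e mulVKf ?gt_eqF.
  by apply: rescale_part; rewrite gt_eqF.
have small e : 0 < e -> (1 - w) * w <= e.
  move=> e0; have [K jK lbK] := leave_bound_small hq hplus hminus j e0.
  have lim_w : (1 - w) * avg (@M n) (fun l => (E (window j (st l)))%:R) @[n --> \oo] -->
      (1 - w) * w by apply: cvgM; [exact: cvg_cst|exact: event_cvg].
  apply: (cvgr_to_le lim_w).
  exists K => // n /= Kn; apply: le_trans (lbK n Kn).
  have b01 (l : signature n.+1) : 0 <= ((E (window j (st l)))%:R : R) <= 1 by exact: ind01.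
  rewrite -lee_fin EFinM -(avgE (MP n) b01) -esumZ ?(ltW wc0) //; last first.
    by move=> l; rewrite mulr_ge0 //; case: (MP n).
  apply: le_trans (tail_part_outside hq hsigma hplus hminus hM (predC E) (leq_trans jK Kn)).
  by apply: le_esum => l _; rewrite lee_fin partE /= negbK mulrA mulrC.
have := small ((1 - w) * w / 2); rewrite divr_gt0 ?mulr_gt0 // => /(_ isT).
by have := mulr_gt0 wc0 w0; move: (_ * w) => x; lra.
Qed.

(** Finitely many windows carry half of the mass at all levels from some K on, so
    one of them has positive limiting mass, which is then 1. *)
Lemma minimal_concentrated (M : system R) :
  minimal_boundary q sigma M -> concentrated sigma M.
Proof.
move=> minM; have [hM _] := minM; have MP k : is_prob_weights (@M k) by case: hM.
move=> j e e0; have e40 : 0 < 1 / 4 :> R by [].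
have [K jK lbK] := leave_bound_small hq hplus hminus j e40.
have [r ur mass_r] : exists2 r : seq (signature K.+1), uniq r &
    1 - 1 / 4 <= \sum_(l <- r) M K l.
  by apply: esum_seq_approx => //; case: (MP K).
pose V := undup [seq window j (st l) | l <- r].
have inV n : (K <= n)%N ->
    1 / 2 <= \sum_(v <- V) avg (@M n) (fun l => (pred1 v (window j (st l)))%:R).
  move=> Kn.
  have b01 k (P : pred (signature k.+1)) l : 0 <= ((P l)%:R : R) <= 1 by exact: ind01.
  have VK : 3 / 4 <= avg (@M K) (fun l => (window j (st l) \in V)%:R).
    apply: le_trans (sum_le_avg (MP K) ur (b01 K _)).
    rewrite big_seq (eq_bigr (fun l => M K l)) -?big_seq; first by move: mass_r; lra.
    move=> l lr; have -> : window j (st l) \in V by rewrite mem_undup; apply/mapP; exists l.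
    by rewrite mulr1.
  have := avg_window_stable hq hsigma (fun v => v \in V) hM jK Kn.
  rewrite ler_distl => /andP[h _]; have lb := lbK K (leqnn K).
  rewrite -(@avg_sum _ _ _ (MP n) _ _ _ (fun=> 1)) => [|v l]; last exact: ind01.
  rewrite (_ : (fun l => \sum_(v <- V) _) = (fun l => (window j (st l) \in V)%:R)).
    by move: h lb VK; move: (leave_bound _ _ _ _) (avg _ _) (avg _ _) => a b c; lra.
  apply/funext => l; have [wV|wV] := boolP (window j (st l) \in V).
    rewrite (bigD1_seq (window j (st l))) ?undup_uniq //= eqxx big1 ?addr0 // => v.
    by rewrite eq_sym => /negPf ->.
  rewrite big_seq big1 // => v vV; rewrite /=; case: eqP => // wv.
  by move: wV; rewrite wv vV.
have [v _ mv] : exists2 v, v \in V & 0 < tail_mass q sigma M (pred1 v).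
  apply: contrapT => none.
  have : 1 / 2 <= \sum_(v <- V) tail_mass q sigma M (pred1 v).
    have lim_V : \sum_(v <- V) avg (@M n) (fun l => (pred1 v (window j (st l)))%:R) @[n --> \oo] -->
        \sum_(v <- V) tail_mass q sigma M (pred1 v).
      by apply: cvgn_sum => v; exact: event_cvg.
    by apply: (cvgr_to_ge lim_V); exists K.
  apply/negP; rewrite -ltNge; apply: (@le_lt_trans _ _ 0); last by lra.
  rewrite big_seq; apply: sumr_le0 => v vV; rewrite leNgt; apply/negP => mv.
  by apply: none; exists v.
have := @event_cvg _ _ _ hq hsigma hplus hminus M j hM (pred1 v).
rewrite (minimal_tail_mass minM mv) => /cvgrPdist_le/(_ e e0)[n0 _ hn0].
exists (maxn n0 j), v; split; first exact: leq_maxr.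
move=> n; rewrite geq_max => /andP[/hn0 /= h _].
rewrite (avg_compl (MP n) (fun l => window j (st l) == v)).
by apply: le_trans h; exact: ler_norm.
Qed.

Lemma oscillation_le_mono k f j j' (e : R) : (j <= j')%N ->
  oscillation_le q sigma k f j e -> oscillation_le q sigma k f j' e.
Proof.
move=> jj osc n l l' jn w; apply: osc; first exact: leq_trans jn.
exact: (window_sub hsigma jj jn w).
Qed.

(** At level n take a signature that shows the limiting value of the largest
    window known to be concentrated by then. *)
Lemma concentrated_Martin (M : system R) : coherent q sigma M ->
  concentrated sigma M -> Martin_boundary q sigma M.
Proof.
move=> hM conc; split => //; have MP k : is_prob_weights (@M k) by case: hM.
pose eta j : R := 2^-1 ^+ j.+1.
have half0 : 0 < 2^-1 :> R by rewrite invr_gt0.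
have half1 : 2^-1 < 1 :> R by rewrite invf_lt1 // ltr1n.
have eta0 j : 0 < eta j by exact: exprn_gt0.
have eta1 j : eta j < 1 by rewrite /eta exprn_ilt1 // ltW.
have ex j : {Kv : nat * {ffun 'I_j.+1 -> int} | (j <= Kv.1)%N /\
    forall n, (Kv.1 <= n)%N -> avg (@M n) (fun l => (window j (st l) != Kv.2)%:R) <= eta j}.
  by apply: cid; have [K [v h]] := conc j (eta j) (eta0 j); exists (K, v).
pose K j := (projT1 (ex j)).1; pose v j := (projT1 (ex j)).2.
have jK j : (j <= K j)%N by rewrite /K; case: (ex j) => ? [].
have bad j n : (K j <= n)%N -> avg (@M n) (fun l => (window j (st l) != v j)%:R) <= eta j.
  by rewrite /K /v; case: (ex j) => ? [] /= _; apply.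
have ne j n : exists l : signature n.+1, (K j <= n)%N -> window j (st l) == v j.
  have [Kn|nKn] := leqP (K j) n; last first.
    have [] := @event_nonempty _ _ _ predT (MP n) => [|l _]; last by exists l.
    apply: (@le_lt_trans _ _ 0) => //; rewrite -[leRHS](avg_cst (MP n) (lexx 0)).
    by apply: (avg_le (MP n) (c := 0) (d := 0)) => l; rewrite /= lexx.
  have [|l wl] := @event_nonempty _ _ _ (fun l => window j (st l) == v j) (MP n); last by exists l.
  exact: le_lt_trans (bad j n Kn) (eta1 j).
(* The largest j whose window is controlled at level n; it tends to infinity with n. *)
pose J n := \max_(j < n.+1 | (K j <= n)%N) j.
pose lam n : signature n.+1 := projT1 (cid (ne (J n) n)).
have lamP n : (K (J n) <= n)%N -> window (J n) (st (lam n)) = v (J n).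
  by move=> h; apply/eqP; rewrite /lam; case: (cid _) => l /=; apply.
have J_large j n : (K j <= n)%N -> (K (J n) <= n)%N /\ (j <= J n)%N.
  move=> Kn; have jn : (j < n.+1)%N by rewrite ltnS (leq_trans (jK j)).
  pose P (i : 'I_n.+1) := (K i <= n)%N; pose F (i : 'I_n.+1) := i : nat.
  split; last exact: (@leq_bigmax_cond _ P F (Ordinal jn) Kn).
  have P0 : (0 < #|P|)%N by apply/card_gt0P; exists (Ordinal jn).
  have [i Pi Ji] := @eq_bigmax_cond _ P F P0.
  by have -> : J n = i := Ji.
exists lam => k m; apply/cvgrPdist_le => e e0.
have e20 : 0 < e / 2 by rewrite divr_gt0.
have f01 (x : state) : 0 <= ((at_level k m) x : R) <= 1 by exact: ind01.
have [j0 kj0 osc] := oscillation_small hq hsigma hplus hminus k f01 e20.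
have [|p hp] := @expr_small R 2^-1 _ _ e20; first by rewrite (ltW half0) half1.
pose j1 := maxn j0 p.
exists (K j1) => // d /= Kd.
have Kn : (K j1 <= d + k)%N by rewrite (leq_trans Kd) ?leq_addr.
have [KJ j1J] := J_large j1 _ Kn.
set n := (d + k)%N in Kn KJ j1J *; set j := J n in KJ j1J.
have jn : (j <= n)%N := leq_trans (jK j) KJ.
have j0j : (j0 <= j)%N by rewrite (leq_trans _ j1J) ?leq_maxl.
have pj : (p <= j.+1)%N by rewrite ltnW // ltnS (leq_trans _ j1J) ?leq_maxr.
rewrite (links_cond_mean hq hsigma).
have badj := bad j n KJ; rewrite -(lamP n KJ) in badj.
apply: le_trans (window_approx hq hsigma hM (leq_addl d k) jn (ltW e20) (oscillation_le_mono j0j osc) badj) _.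
by have := hp j.+1 pj; rewrite -/(eta j); move: (eta j) => x; lra.
Qed.

End Boundaries.

Theorem theorem5p7 (R : realType) (q : R) (sigma : nat -> int)
  (hq : 0 < q < 1)
  (hsigma : forall N : nat, (0 < N)%N -> sigma N = 1 \/ sigma N = -1)
  (hplus : forall m : nat, exists2 N : nat, (m <= N)%N & sigma N = 1)
  (hminus : forall m : nat, exists2 N : nat, (m <= N)%N & sigma N = -1) :
  minimal_boundary q sigma = Martin_boundary q sigma.
Proof.
apply/seteqP; split=> M h.
  have [hM _] := h; apply: (concentrated_Martin hq hsigma hplus hminus hM).
  exact: (minimal_concentrated hq hsigma hplus hminus).
have conc := Martin_concentrated hq hsigma hplus hminus h.
have [hM _] := h; split => // M1 M2 a hM1 hM2 /andP[a0 a1] dec.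
have M0 (M' : system R) : coherent q sigma M' -> forall k (l : signature k.+1), 0 <= M' k l.
  by move=> [MP _] k l; have [] := MP k.
have a1' : 0 < 1 - a by rewrite subr_gt0.
have -> : M1 = M.
  apply: (concentrated_dominates hq hsigma hplus hminus (C := a^-1) hM hM1) => //.
    by rewrite invr_ge0 ltW.
  move=> k l; rewrite ler_pdivlMl // dec lerDl mulr_ge0 ?(ltW a1') //; exact: M0.
symmetry; apply: (concentrated_dominates hq hsigma hplus hminus (C := (1 - a)^-1) hM hM2) => //.
  by rewrite invr_ge0 ltW.
move=> k l; rewrite ler_pdivlMl // dec lerDr mulr_ge0 ?(ltW a0) //; exact: M0.
Qed.
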